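(* Let the tree data $T,k,b_j,\tilde p_j,\alpha_j$, the spaces $W_{2,\alpha}^s$ and the expressions $\ell_j$ be as defined in the context, and let $\varphi_0,\varphi_1\in\mathbb{C}$. Consider the conditions (A) $y_1(0)=\varphi_0$; (B) $y_{k_j}(1)=y_j(0)$ for all $j\ge 2$; (C) $y_j(1)=\varphi_1$ for all $j\in\mathbb{N}_2$. Let $\mathcal{V}$ denote the variational problem of minimizing $$J(y)=\sum_{j=1}^\infty \alpha_j\int_0^1|\ell_j y(t)|^2\,dt$$ over all $y=[y_j]\in W_{2,\alpha}^1$ satisfying (A), (B), (C); a solution of $\mathcal{V}$ is a tuple $y\in W_{2,\alpha}^1$ satisfying (A), (B), (C) at which this minimum is attained. Then a tuple $y=[y_j]\in W_{2,\alpha}^1$ is a solution of $\mathcal{V}$ if and only if $y\in W_{2,\alpha}^2$ and $y$ is a solution of the following boundary value problem $\mathcal{B}$: the equations $$-y_j''(t)-2i(\mathrm{Im}\,b_j)\,y_j'(t)+|b_j|^2y_j(t)=0,\quad 0<t<1,\quad j\in\mathbb{N},$$ the conditions (A), (B), (C), and the Kirchhoff-type conditions $$y_j'(1)+\beta_jy_j(1)=\sum_{\nu\in V_j}\tilde p_\nu\, y_\nu'(0),\qquad \beta_j:=b_j-\sum_{\nu\in V_j}\tilde p_\nu b_\nu,\qquad j\in\mathbb{N}_1.$$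
   Context: Tree. $\mathbb{N}=\{1,2,\dots\}$. Fix an integer $T\ge2$. If $T\ge3$, let $\mathbb{N}_1$ be the set of odd positive integers and $\mathbb{N}_2=\mathbb{N}\setminus\mathbb{N}_1$; if $T=2$, let $\mathbb{N}_1=\{1\}$ and $\mathbb{N}_2=\mathbb{N}\setminus\{1\}$. The infinite rooted tree $\mathcal{T}$ has vertices $v_0,v_1,v_2,\dots$; $v_0$ is the root, the $v_j$ with $j\in\mathbb{N}_1$ are the internal vertices and the $v_j$ with $j\in\mathbb{N}_2\cup\{0\}$ are the boundary vertices. Its edges are $e_j=[v_{k_j},v_j]$, $j\in\mathbb{N}$, where $j\mapsto k_j$ is a map from $\mathbb{N}$ onto $\mathbb{N}_1\cup\{0\}$. Put $V_j=\{\nu\in\mathbb{N}:k_\nu=j\}$ for $j\in\mathbb{N}_1\cup\{0\}$ (indices of the edges leaving $v_j$). The map satisfies: $k_1=0$ and $V_0=\{1\}$; $V_j$ is countably infinite for every $j\in\mathbb{N}_1$; for each $j\in\mathbb{N}$, with $k_j^{\{0\}}=j$ and $k_j^{\{\nu+1\}}=k_{k_j^{\{\nu\}}}$, there is $\nu_j\ge0$ with $k_j^{\{\nu_j\}}=1$; and the tree has exactly $T$ tiers with all leaves other than the root at the last tier, i.e. $\nu_j+1\le T-1$ for $j\in\mathbb{N}_1$ and $\nu_j+1=T$ for $j\in\mathbb{N}_2$. Each edge $e_j$ is parametrized by $t\in[0,1]$, with $t=0$ at $v_{k_j}$ and $t=1$ at $v_j$. Coefficients and weights. Given are $b_1\in\mathbb{C}$,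 a sequence $(\theta_l)_{l\in\mathbb{N}}\subset\mathbb{C}$ with $\sup_l|\theta_l|<\infty$, and numbers $p_l>0$ with $\sum_{l=1}^\infty p_l=1$. For each $j\in\mathbb{N}_1$ enumerate $V_j=\{\nu_{j,l}\}_{l\in\mathbb{N}}$ (without repetition) and set $b_{\nu_{j,l}}=\theta_l$, $\tilde p_{\nu_{j,l}}=p_l$. This defines $b_j$ for all $j\in\mathbb{N}$ and $\tilde p_j$ for all $j\ge2$. Set $\alpha_1=1$ and $\alpha_j=\prod_{\nu=0}^{\nu_j-1}\tilde p_{k_j^{\{\nu\}}}$ for $j\ge2$; equivalently $\alpha_j=\tilde p_j\alpha_{k_j}$ for $j\ge2$. Spaces. For an integer $s\ge0$, $W_{2,\alpha}^s$ is the Hilbert space of tuples $y=[y_j]_{j\in\mathbb{N}}$ of complex-valued functions $y_j\in W_2^s[0,1]$ (Sobolev space; $W_2^0=L_2$) with $\|y\|_s^2=\langle y,y\rangle_s<\infty$, where $\langle y,z\rangle_s=\sum_{j=1}^\infty\alpha_j\langle y_j,z_j\rangle_{W_2^s[0,1]}$. Expressions. For $y=[y_j]$, $\ell_jy(t)=y_j'(t)+b_jy_j(t)$, $0<t<1$, $j\in\mathbb{N}$. *)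

(* Defs.v *)
From HB Require Import structures.
From mathcomp Require Import all_boot all_order all_algebra.
From mathcomp Require Import complex.
From mathcomp Require Import all_classical all_reals all_analysis.
Set Implicit Arguments.
Unset Strict Implicit.
Unset Printing Implicit Defensive.
Import Order.TTheory GRing.Theory Num.Theory.
Import numFieldNormedType.Exports.
Export complex.ComplexField.Normc.

Local Open Scope classical_set_scope.
Local Open Scope complex_scope.
Local Open Scope ring_scope.

(** * The tree

    Vertices and edges carry their usual indices; [e_j] goes from [v_(k j)] to
    [v_j].  Only the values [k j] with [0 < j] are meaningful, and a tuple
    indexed by the edges is a function on [nat] whose value at [0] is never
    used. *)

Definition internal (T : nat) : pred nat :=
  [pred j | if T == 2%N then j == 1%N else odd j].

Definition leaf (T : nat) : pred nat :=
  [pred j | (0 < j)%N && ~~ internal T j].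

Definition children (k : nat -> nat) (j : nat) : set nat :=
  [set i | (0 < i)%N /\ k i = j].

(** [d j] is the number of parent steps from [v_j] down to [v_1].  As [k 0] is
    unspecified, iterating [k] past [v_1] is meaningless: [tree_depth_first]
    makes [d j] the first hitting time, hence unique. *)
Record tiered_tree (T : nat) (k d : nat -> nat) : Prop := TieredTree {
  tree_into : forall j, (0 < j)%N -> k j = 0%N \/ internal T (k j);
  tree_onto : forall i, i = 0%N \/ internal T i ->
    exists2 j, (0 < j)%N & k j = i;
  tree_root : children k 0 = [set 1%N];
  tree_children_infinite : forall j, internal T j -> infinite_set (children k j);
  tree_depth : forall j, (0 < j)%N -> iter (d j) k j = 1%N;
  tree_depth_first : forall j m, (0 < j)%N -> (m < d j)%N -> iter m k j <> 1%N;
  tree_internal_tier : forall j, internal T j -> (d j + 1 <= T - 1)%N;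
  tree_leaf_tier : forall j, leaf T j -> (d j + 1 = T)%N
}.

Definition edge_weight (R : realType) (k d : nat -> nat) (pt : nat -> R)
  (j : nat) : R := \prod_(m < d j) pt (iter m k j).

(** * Sobolev spaces on [0,1] *)

Definition unit_itv (R : realType) : set R := `[0, 1]%classic.

(** Derivative on [0,1] by difference quotients inside [0,1]: two-sided at
    interior points, one-sided at [0] and [1]. *)
Definition deriv01_real (R : realType) (f : R -> R) (t : R) : R :=
  lim ((s - t)^-1 * (f s - f t) @[s --> within (@unit_itv R) t^']).

Definition deriv01 (R : realType) (f : R -> R[i]) (t : R) : R[i] :=
  deriv01_real (fun s => complex.Re (f s)) t
    +i* deriv01_real (fun s => complex.Im (f s)) t.

Definition abs_cont01 (R : realType) (f : R -> R[i]) : Prop :=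
  forall e : R, 0 < e -> exists2 dlt : R, 0 < dlt &
    forall (n : nat) (a b : 'I_n -> R),
      (forall i, [/\ 0 <= a i, a i <= b i & b i <= 1]) ->
      trivIset [set: 'I_n] (fun i => `]a i, b i[%classic) ->
      \sum_(i < n) (b i - a i) < dlt ->
      \sum_(i < n) normc (f (b i) - f (a i)) < e.

Definition sqnorm_L2 (R : realType) (f : R -> R[i]) : \bar R :=
  (\int[lebesgue_measure]_(t in @unit_itv R) (normc (f t) ^+ 2)%:E)%E.

(** [measurable_fun] is Borel measurability; Lebesgue measurable functions are
    those that agree almost everywhere with a Borel one. *)
Definition in_L2 (R : realType) (f : R -> R[i]) : Prop :=
  (exists g : R -> R[i],
    [/\ measurable_fun (@unit_itv R) (fun t => complex.Re (g t)),
        measurable_fun (@unit_itv R) (fun t => complex.Im (g t)) &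
        f = g %[ae lebesgue_measure in @unit_itv R]]) /\
  (sqnorm_L2 f < +oo)%E.

(** [f, f', .., f^(s-1)] absolutely continuous and [f^(s)] in [L_2].  The value
    of [deriv01] where the limit does not exist is harmless: an absolutely
    continuous function is differentiable almost everywhere, and if its
    [deriv01] is continuous then it is differentiable on all of [0,1]. *)
Definition sobolev (R : realType) (s : nat) (f : R -> R[i]) : Prop :=
  (forall m, (m < s)%N -> abs_cont01 (iter m (@deriv01 R) f)) /\
  in_L2 (iter s (@deriv01 R) f).

Definition sqnorm_sobolev (R : realType) (s : nat) (f : R -> R[i]) : \bar R :=
  (\sum_(m < s.+1) sqnorm_L2 (iter m (@deriv01 R) f))%E.

Definition weighted_sobolev (R : realType) (alpha : nat -> R) (s : nat)
    (y : nat -> R -> R[i]) : Prop :=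
  (forall j, (0 < j)%N -> sobolev s (y j)) /\
  (\sum_(1 <= j <oo) (alpha j)%:E * sqnorm_sobolev s (y j) < +oo)%E.

(** * The two problems *)

Definition vertex_conditions (R : realType) (T : nat) (k : nat -> nat)
    (phi0 phi1 : R[i]) (y : nat -> R -> R[i]) : Prop :=
  [/\ y 1%N 0 = phi0,
      forall j, (2 <= j)%N -> y (k j) 1 = y j 0 &
      forall j, leaf T j -> y j 1 = phi1].

Definition ell (R : realType) (b : nat -> R[i]) (y : nat -> R -> R[i])
  (j : nat) (t : R) : R[i] := deriv01 (y j) t + b j * y j t.

Definition energy (R : realType) (alpha : nat -> R) (b : nat -> R[i])
    (y : nat -> R -> R[i]) : \bar R :=
  (\sum_(1 <= j <oo) (alpha j)%:E *
    \int[lebesgue_measure]_(t in @unit_itv R) (normc (ell b y j t) ^+ 2)%:E)%E.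

Definition variational_solution (R : realType) (T : nat) (k : nat -> nat)
    (alpha : nat -> R) (b : nat -> R[i]) (phi0 phi1 : R[i])
    (y : nat -> R -> R[i]) : Prop :=
  [/\ weighted_sobolev alpha 1 y,
      vertex_conditions T k phi0 phi1 y &
      forall z, weighted_sobolev alpha 1 z ->
        vertex_conditions T k phi0 phi1 z ->
        (energy alpha b y <= energy alpha b z)%E].

(** Sums over [V_j] are taken along the enumeration [nu j].  Under the
    hypotheses in force the series below converge absolutely, so the
    enumeration does not matter. *)
Definition beta (R : realType) (nu : nat -> nat -> nat) (pt : nat -> R)
    (b : nat -> R[i]) (j : nat) : R[i] :=
  b j - (lim (series (fun l => (pt (nu j l))%:C * b (nu j l) : R[i]^o) @ \oo)).

Definition kirchhoff_conditions (R : realType) (T : nat)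
    (nu : nat -> nat -> nat) (pt : nat -> R) (b : nat -> R[i])
    (y : nat -> R -> R[i]) : Prop :=
  forall j, internal T j ->
    series (fun l => (pt (nu j l))%:C * deriv01 (y (nu j l)) 0 : R[i]^o) @ \oo
      --> (deriv01 (y j) 1 + beta nu pt b j * y j 1 : R[i]^o).

(** For [y j] in [W_2^2] the second derivative is an [L_2] function, and the
    differential equation is an equality of such functions. *)
Definition edge_equations (R : realType) (b : nat -> R[i])
    (y : nat -> R -> R[i]) : Prop :=
  forall j, (0 < j)%N ->
    {ae lebesgue_measure, forall t : R, `]0, 1[%classic t ->
      - deriv01 (deriv01 (y j)) t
      - 2 * 'i%C * (complex.Im (b j))%:C * deriv01 (y j) t
      + (normc (b j) ^+ 2)%:C * y j t = 0}.

Definition boundary_value_solution (R : realType) (T : nat) (k : nat -> nat)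
    (nu : nat -> nat -> nat) (pt : nat -> R) (b : nat -> R[i])
    (phi0 phi1 : R[i]) (y : nat -> R -> R[i]) : Prop :=
  [/\ edge_equations b y,
      vertex_conditions T k phi0 phi1 y &
      kirchhoff_conditions T nu pt b y].

(* Main.v *)
Require Import Defs.
From HB Require Import structures.
From mathcomp Require Import all_boot all_order all_algebra.
From mathcomp Require Import complex.
From mathcomp Require Import all_classical all_reals all_analysis.
From mathcomp Require Import measurable_realfun.
From mathcomp Require Import ring lra.
Set Implicit Arguments.
Unset Strict Implicit.
Unset Printing Implicit Defensive.
Import Order.TTheory GRing.Theory Num.Theory.
Import numFieldNormedType.Exports.
Local Open Scope classical_set_scope.
Local Open Scope complex_scope.
Local Open Scope ring_scope.

(** The Euler-Lagrange operator on an edge factors as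
    [(- d/dt + conj b_j) (d/dt + b_j)], so [y] satisfies the differential
    equation exactly when [q_j := y_j' + b_j y_j] is absolutely continuous with
    [q_j' = conj b_j q_j].  For such [y] and an admissible variation [h],
    Green's identity on every edge, regrouped by the children of each internal
    vertex, leaves
      [sum_i alpha_i (h_i(1) . q_i(1) - sum_l p_l h_i(1) . q_{nu i l}(0))],
    and the vanishing of the brackets is the Kirchhoff condition.  Conversely, a
    minimizer agrees on each edge with the extremal having the same end values,
    the strict convexity of the energy on that edge leaving no other choice, and
    testing with functions supported at a single vertex gives the Kirchhoff
    conditions.

    The fundamental theorem of calculus for absolutely continuous functions is
    obtained by writing [f] as the difference of its variation and a
    nondecreasing function, both absolutely continuous: their Stieltjes measures
    are then absolutely continuous with respect to Lebesgue measure and have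
    Radon-Nikodym densities. *)

(** * Absolutely continuous real functions *)

(** The main obstacle is regularity. A minimizer lies only in [W_2^1], so its [q_j] is controlled
    almost everywhere at best and has a priori neither end values nor a derivative. Comparison with
    an explicit extremal on a single edge takes the place of a du Bois-Reymond argument: the
    replacement keeps the end values, hence stays admissible, and identifies [y_j] with an
    exponential expression at every point of [0,1]. Only then do [q_j(0)] and [q_j(1)] carry
    meaning. The other obstacle is that infinitely many edges leave each internal vertex. Regrouping
    by vertices requires absolutely summable boundary terms: end values of [h_j] are bounded by its
    [W_2^1] norm, those of [q_j] by the edge energy, since [|q_j'| = |b_j| |q_j|] and the [b_j] are
    uniformly bounded. A test tuple centred at one vertex has finite norm because the weights of the
    children add up to the weight of the parent. Complex numbers are paired by the real part of
    [z conj w], and variations use a real parameter; testing with the values 1 and [i] recovers the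
    complex condition. *)

Definition real_ac (R : realType) (f : R -> R) : Prop :=
  forall e : R, 0 < e -> exists2 dlt : R, 0 < dlt &
    forall (n : nat) (a b : 'I_n -> R),
      (forall i, [/\ 0 <= a i, a i <= b i & b i <= 1]) ->
      trivIset [set: 'I_n] (fun i => `]a i, b i[%classic) ->
      \sum_(i < n) (b i - a i) < dlt ->
      \sum_(i < n) `|f (b i) - f (a i)| < e.

Section AbsoluteContinuity.
Variable R : realType.
Implicit Types f g : R -> R.

(** An arbitrary finite index type is convenient because subdividing several intervals at once
    produces a family indexed by a dependent sum. *)
Lemma real_ac_fin f : real_ac f -> forall e : R, 0 < e ->
  exists2 dlt : R, 0 < dlt & forall (I : finType) (a b : I -> R),
    (forall i, [/\ 0 <= a i, a i <= b i & b i <= 1]) ->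
    trivIset [set: I] (fun i => `]a i, b i[%classic) ->
    \sum_i (b i - a i) < dlt -> \sum_i `|f (b i) - f (a i)| < e.
Proof.
move=> acf e /acf[dl dl0 H]; exists dl => // I a b ab tI s.
rewrite big_enum_val; apply: (H #|I| (a \o enum_val) (b \o enum_val)).
- by move=> i; exact: ab.
- apply/trivIsetP => i j _ _ ij; move/trivIsetP: tI; apply => //.
  by apply: contra ij => /eqP/enum_val_inj ->.
- by move: s; rewrite big_enum_val.
Qed.

Lemma real_ac_dist f : real_ac f -> forall e : R, 0 < e ->
  exists2 dlt : R, 0 < dlt & forall a b, 0 <= a -> a <= b -> b <= 1 ->
    b - a < dlt -> `|f b - f a| < e.
Proof.
move=> acf e /(real_ac_fin acf)[dl dl0 H]; exists dl => // a b a0 ab b1 dab.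
have := H 'I_1 (fun=> a) (fun=> b).
rewrite !big_ord1; apply => //.
by apply/trivIsetP => i j; rewrite !ord1 eqxx.
Qed.

(** Subdividing each interval keeps the family disjoint and its total length unchanged, so the same
    [dlt] works for the refined family, whose increments are the terms of the variations. *)
Lemma real_ac_variation f : real_ac f -> forall e : R, 0 < e ->
  exists2 dlt : R, 0 < dlt & forall (I : finType) (a b : I -> R),
    (forall i, [/\ 0 <= a i, a i <= b i & b i <= 1]) ->
    trivIset [set: I] (fun i => `]a i, b i[%classic) ->
    \sum_i (b i - a i) < dlt ->
    forall s : I -> seq R, (forall i, itv_partition (a i) (b i) (s i)) ->
    \sum_i variation (a i) (b i) f (s i) < e.
Proof.
move=> acf e /(real_ac_fin acf)[dl dl0 H]; exists dl => // I a b ab tI hs s ps.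
(* A pair consisting of an interval and one of its cells; [x i m] is the [m]-th division point of
   interval [i], the left end being number 0. *)
pose J := {i : I & 'I_(size (s i))}.
pose x (i : I) m := nth (b i) (a i :: s i) m.
pose a' (j : J) := x (tag j) (tagged j); pose b' (j : J) := x (tag j) (tagged j).+1.
have S (F : I -> nat -> R) :
    \sum_i \sum_(0 <= n < size (s i)) F i n = \sum_(j : J) F (tag j) (tagged j).
  rewrite (eq_bigr (fun i => \sum_(n < size (s i)) F i n)); last first.
    by move=> i _; rewrite big_mkord.
  by rewrite sig_big_dep.
rewrite /variation /= (S (fun i n => `|f (x i n.+1) - f (x i n)|)).
have xge i m : (m <= size (s i))%N -> a i <= x i m.
  by move=> ms; rewrite /x (itv_partition_nth_ge (b:=b i)).
have xle i m : (m <= size (s i))%N -> x i m <= b i.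
  by move=> ms; rewrite /x (itv_partition_nth_le (a:=a i)).
have xmono i m n : (m <= n <= size (s i))%N -> x i m <= x i n.
  move=> /andP[mn ns]; rewrite /x.
  have [pth _] := ps i.
  have srt : sorted <=%R (a i :: s i).
    by apply: (@sub_path _ <%R) pth => u v /ltW.
  apply: (sorted_leq_nth le_trans le_refl) => //.
  by rewrite inE /= ltnS (leq_trans mn ns).
apply: (H J a' b').
- move=> [i m]; rewrite /a' /b' /=; have [a0 _ b1] := ab i; split.
  + by apply: (le_trans a0); apply: xge; rewrite ltnW.
  + by apply: xmono; rewrite leqnSn /=.
  + by apply: le_trans b1; apply: xle.
- apply/trivIsetP => -[i m] [j n] _ _; rewrite /a' /b' /=.
  have [ij|ij _] := eqVneq i j; last first.
    move/trivIsetP: tI => /(_ i j Logic.I Logic.I ij); apply: subsetI_eq0;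
      apply: subset_itvW => //; by [apply: xge; rewrite ltnW | apply: xle].
  have disj (u v : 'I_(size (s i))) : (u < v)%N ->
      `]x i u, x i u.+1[%classic `&` `]x i v, x i v.+1[%classic = set0.
    move=> uv; rewrite -subset0 => y /= [/=]; rewrite !in_itv /=.
    move=> /andP[_ yu] /andP[yv _].
    have := lt_trans yv yu; apply/negP; rewrite -leNgt.
    by apply: xmono; rewrite uv ltnW.
  subst j; move=> mn; have {}mn : val m != val n.
    by apply: contra mn => /eqP/val_inj ->.
  move: mn; rewrite neq_ltn => /orP[|] mn; first exact: disj.
  by rewrite setIC; exact: disj.
- apply: le_lt_trans hs.
  rewrite -(S (fun i n => x i n.+1 - x i n)); apply: ler_sum => i _.
  rewrite telescope_sumr //; have [_ /eqP lst] := ps i.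
  by rewrite /x /= -last_nth lst.
Qed.

(** For [e = 1] every sufficiently short interval has total variation at most 1. Finitely many
    intervals of length [N.+1%:R^-1] fill [0,1], and total variation is additive. *)
Lemma real_ac_bv f : real_ac f -> bounded_variation 0 1 f.
Proof.
move=> acf; have [dl dl0 H] := real_ac_variation acf ltr01.
have small a b : 0 <= a -> a <= b -> b <= 1 -> b - a < dl ->
    total_variation a b f \is a fin_num.
  move=> a0 ab b1 dab; apply/bounded_variationP => //; exists 1 => _ [s ps <-].
  have h : variation a b f s < 1; last exact: ltW.
  have := H 'I_1 (fun=> a) (fun=> b) _ _ _ (fun=> s).
  rewrite !big_ord1; apply => //.
  by apply/trivIsetP => i j; rewrite !ord1 eqxx.
have [N dlN] : exists N, N.+1%:R^-1 < dl.
  exists (Num.bound dl^-1); rewrite invf_plt ?posrE//.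
  have dli : 0 <= dl^-1 by rewrite invr_ge0 ltW.
  by rewrite (lt_le_trans (archi_boundP dli))// ler_nat.
suff P m : (m <= N.+1)%N -> total_variation 0 (m%:R / N.+1%:R) f \is a fin_num.
  apply/bounded_variationP => //; have := P N.+1 (leqnn _).
  by rewrite divff.
elim: m => [_|m IH mN]; first by rewrite mul0r total_variationxx.
rewrite (@total_variationD _ _ _ (m%:R / N.+1%:R)).
- rewrite fin_numD; apply/andP; split; first exact/IH/ltnW.
  apply: small.
  + by rewrite divr_ge0.
  + by rewrite ler_pM2r ?invr_gt0// ler_nat.
  + by rewrite ler_pdivrMr// mul1r ler_nat.
  + by rewrite -mulrBl -natrB// subSnn mul1r.
- by rewrite divr_ge0.
- by rewrite ler_pM2r ?invr_gt0// ler_nat.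
Qed.

Lemma real_ac_bounded f : real_ac f ->
  exists M : R, forall t : R, 0 <= t <= 1 -> `|f t| <= M.
Proof.
move=> acf; have /bounded_variationP := real_ac_bv acf => /(_ ler01) fin.
exists (`|f 0| + fine (total_variation 0 1 f)) => t /andP[t0 t1].
rewrite -[f t](subrK (f 0)) addrC (le_trans (ler_normD _ _))// lerD2l.
rewrite -lee_fin fineK// (le_trans (total_variation_ge _ _))//.
by rewrite (@total_variationD _ 0 1 t)// leeDl// total_variation_ge0.
Qed.

(** Retraction of the line onto [0,1]. Stieltjes measures ask for a function that is monotone and
    right continuous on all of [R], while absolute continuity is known on [0,1] only. *)
Definition clamp01 (x : R) : R := Num.max 0 (Num.min 1 x).

Lemma clamp01_itv x : 0 <= clamp01 x <= 1.
Proof. by rewrite /clamp01 le_max lexx /= ge_max ler01 ge_min lexx. Qed.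

Lemma clamp01_id x : 0 <= x <= 1 -> clamp01 x = x.
Proof. by move=> /andP[x0 x1]; rewrite /clamp01 min_r// max_r. Qed.

Lemma clamp01_le x y : x <= y -> clamp01 x <= clamp01 y.
Proof.
move=> xy; rewrite /clamp01 ge_max le_max lexx /= le_max.
by apply/orP; right; rewrite le_min !ge_min lexx xy /= orbT.
Qed.

Lemma clamp01_lip x y : x <= y -> clamp01 y - clamp01 x <= y - x.
Proof.
move=> xy; rewrite /clamp01.
by case: (leP 1 x) => x1; case: (leP 1 y) => y1;
  rewrite ?maxEle; repeat (case: ifPn; rewrite -?ltNge => ?); lra.
Qed.

Definition tv_fun f (x : R) : R := fine (total_variation 0 (clamp01 x) f).

Lemma tv_funB f a b : real_ac f -> 0 <= a -> a <= b -> b <= 1 ->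
  (tv_fun f b - tv_fun f a)%:E = total_variation a b f.
Proof.
move=> acf a0 ab b1; have BV := real_ac_bv acf.
rewrite /tv_fun !clamp01_id ?a0 ?b1 ?(le_trans ab)// ?(le_trans a0)//.
have fa : total_variation 0 a f \is a fin_num.
  by apply/bounded_variationP => //; apply: bounded_variationl BV => //; apply: le_trans b1.
have fb : total_variation 0 b f \is a fin_num.
  apply/bounded_variationP; first exact: le_trans ab.
  by apply: bounded_variationl BV => //; apply: le_trans ab.
rewrite EFinB !fineK//; rewrite (total_variationD f a0 ab) in fb *.
by rewrite addeAC subee// add0e.
Qed.

Lemma tv_fun_nd f : real_ac f -> {homo tv_fun f : x y / x <= y}.
Proof.
move=> acf x y xy; have /andP[x0 x1] := clamp01_itv x.
have /andP[y0 y1] := clamp01_itv y.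
have E z : tv_fun f z = tv_fun f (clamp01 z).
  by rewrite /tv_fun (clamp01_id (clamp01_itv z)).
rewrite -subr_ge0 -lee_fin E (E x) tv_funB//; last exact: clamp01_le.
exact/total_variation_ge0/clamp01_le.
Qed.

Lemma tv_funB_ge f a b : real_ac f -> 0 <= a -> a <= b -> b <= 1 ->
  `|f b - f a| <= tv_fun f b - tv_fun f a.
Proof.
by move=> acf a0 ab b1; rewrite -lee_fin tv_funB//; exact: total_variation_ge.
Qed.

(** On each interval the increment of [tv_fun f] is a supremum of variations, so a partition nearly
    attains it; [real_ac_variation] then bounds all these variations together. *)
Lemma real_ac_tv f : real_ac f -> real_ac (tv_fun f).
Proof.
move=> acf e e0; have e20 : 0 < e / 4 by rewrite divr_gt0.
have [dl dl0 H] := real_ac_variation acf e20; exists dl => // n a b ab tI hs.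
(* The error allowed on each interval; the [n] errors add up to at most [e / 4]. The successor keeps
   the quotient positive for the empty family. *)
have e1 : 0 < e / (4 * n.+1%:R) by rewrite divr_gt0// mulr_gt0.
have ex i : exists s, itv_partition (a i) (b i) s /\
    `|tv_fun f (b i) - tv_fun f (a i)| <= variation (a i) (b i) f s + e / (4 * n.+1%:R).
  have [a0 le1 b1] := ab i; rewrite ger0_norm ?subr_ge0 ?tv_fun_nd//.
  have fin : total_variation (a i) (b i) f \is a fin_num by rewrite -tv_funB.
  have [_ [_ [s ps <-] <-] h] := ub_ereal_sup_adherent e1 fin.
  exists s; split => //; rewrite -lerBlDr -lee_fin EFinB tv_funB//; exact: ltW.
have /choice [s hsp] := ex.
have := H _ a b ab tI hs s (fun i => (hsp i).1).
move=> lt1; apply: (@le_lt_trans _ _ (\sum_(i < n) variation (a i) (b i) f (s i) + e / 4)).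
  rewrite (le_trans (ler_sum _ (fun i _ => (hsp i).2)))// big_split /= lerD2l.
  rewrite sumr_const card_ord -(mulr_natr _ n) invfM [e * _]mulrA.
  by rewrite -[leRHS]mulr1 -mulrA ler_pM2l// mulrC ler_pdivrMr// mul1r ler_nat.
lra.
Qed.

Lemma real_acD f g : real_ac f -> real_ac g -> real_ac (fun t => f t + g t).
Proof.
move=> acf acg e e0; have e20 : 0 < e / 2 by rewrite divr_gt0.
have [d1 d10 H1] := acf _ e20; have [d2 d20 H2] := acg _ e20.
exists (Num.min d1 d2); first by rewrite lt_min d10.
move=> n a b ab tI; rewrite lt_min => /andP[s1 s2].
have h1 := H1 _ _ _ ab tI s1; have h2 := H2 _ _ _ ab tI s2.
rewrite [e]splitr; apply: le_lt_trans (ltrD h1 h2); rewrite -big_split /=.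
by apply: ler_sum => i _; rewrite opprD addrACA ler_normD.
Qed.

Lemma real_ac_lip (f g : R -> R) M : real_ac f ->
  (forall a b, 0 <= a -> a <= b -> b <= 1 -> `|g b - g a| <= M * `|f b - f a|) ->
  real_ac g.
Proof.
move=> acf H e e0; pose K := `|M| + 1; have K0 : 0 < K by rewrite ltr_wpDl.
have eK : 0 < e / K by rewrite divr_gt0.
have [d1 d10 H1] := acf _ eK; exists d1 => // n a b ab tI s.
have := H1 _ _ _ ab tI s; rewrite ltr_pdivlMr//; apply: le_lt_trans.
rewrite mulr_suml; apply: ler_sum => i _; have [a0 le1 b1] := ab i.
rewrite (le_trans (H _ _ a0 le1 b1))// mulrC ler_wpM2l//.
by rewrite (le_trans (ler_norm _))// lerDl.
Qed.

Lemma real_ac_id : real_ac (@id R).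
Proof.
move=> e e0; exists e => // n a b ab tI; apply: le_lt_trans.
by apply: ler_sum => i _; have [a0 le1 b1] := ab i; rewrite ger0_norm ?subr_ge0.
Qed.

Lemma real_acZ c f : real_ac f -> real_ac (fun t => c * f t).
Proof.
move=> acf; apply: (@real_ac_lip f _ `|c| acf) => a b _ _ _.
by rewrite -mulrBr normrM.
Qed.

(** With [M] and [N] bounding [f] and [g], increments of the product are dominated by those of
    [N * tv_fun f + M * tv_fun g], which is absolutely continuous and nondecreasing. *)
Lemma real_acM f g : real_ac f -> real_ac g -> real_ac (fun t => f t * g t).
Proof.
move=> acf acg e e0.
have [M hM] := real_ac_bounded acf; have [N hN] := real_ac_bounded acg.
have M0 : 0 <= M by apply: le_trans (hM 0 _); rewrite ?normr_ge0 ?lexx ?ler01.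
have N0 : 0 <= N by apply: le_trans (hN 0 _); rewrite ?normr_ge0 ?lexx ?ler01.
have [d d0 H] := real_acD (real_acZ N (real_ac_tv acf)) (real_acZ M (real_ac_tv acg)) e0.
exists d => // n a b ab tI s; apply: le_lt_trans (H _ _ _ ab tI s).
apply: ler_sum => i _; have [a0 le1 b1] := ab i => /=.
rewrite [leRHS]ger0_norm; last first.
  by rewrite subr_ge0 lerD// ler_wpM2l// tv_fun_nd.
have -> : f (b i) * g (b i) - f (a i) * g (a i) =
  f (b i) * (g (b i) - g (a i)) + (f (b i) - f (a i)) * g (a i) by ring.
rewrite (le_trans (ler_normD _ _))// !normrM opprD addrACA -!mulrBr addrC.
apply: lerD.
  apply: ler_pM => //; last exact: tv_funB_ge.
  by apply: hM; rewrite b1 (le_trans a0).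
rewrite mulrC; apply: ler_pM => //; last exact: tv_funB_ge.
by apply: hN; rewrite a0 (le_trans le1).
Qed.

End AbsoluteContinuity.

(** * Stieltjes measures of absolutely continuous functions and the fundamental theorem of
    calculus *)

Section Stieltjes.
Variable R : realType.
Implicit Types f g : R -> R.
Local Notation mu := (@lebesgue_measure R).

Lemma lebesgue_stieltjes_oc (G : cumulative R R) (a b : R) : a <= b ->
  lebesgue_stieltjes_measure G `]a, b] = (G b - G a)%:E.
Proof.
move=> ab; rewrite /lebesgue_stieltjes_measure /measure_extension.
by rewrite measurable_mu_extE /= ?wlength_itv_bnd//; exact: is_ocitv.
Qed.

Lemma open_interval_sub01 (I : set R) : open I -> is_interval I ->
  I `<=` `]0, 1[ -> exists ab : R * R,
  [/\ 0 <= ab.1, ab.1 <= ab.2, ab.2 <= 1 & I = `]ab.1, ab.2[%classic].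
Proof.
move=> oI iI I01; have [->|/set0P I0] := eqVneq I set0.
  by exists (0, 0) => /=; rewrite set_itv_ge ?bnd_simp ?ltxx// ler01.
have lI : lbound I 0 by move=> x /I01; rewrite /= in_itv /= => /andP[/ltW].
have uI : ubound I 1 by move=> x /I01; rewrite /= in_itv /= => /andP[_ /ltW].
have hi : has_inf I by split => //; exists 0.
have hs : has_sup I by split => //; exists 1.
exists (inf I, sup I); split => /=.
- exact: lb_le_inf.
- have [x Ix] := I0; apply: (@le_trans _ _ x).
    by apply: ge_inf => //; exists 0.
  by apply: ub_le_sup => //; exists 1.
- exact: ge_sup.
- apply/seteqP; split => x.
    move=> Ix; rewrite /= in_itv /=.
    have [e /= e0 He] := oI x Ix.
    have e2 : 0 < e / 2 by rewrite divr_gt0.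
    have H (d : R) : `|d| < e -> I (x + d).
      by move=> de; apply: He => /=; rewrite opprD addNKr normrN.
    apply/andP; split.
      have : inf I <= x - e / 2.
        apply: ge_inf; first by exists 0.
        by apply: H; rewrite normrN gtr0_norm//; lra.
      by lra.
    have : x + e / 2 <= sup I.
      apply: ub_le_sup; first by exists 1.
      by apply: H; rewrite gtr0_norm//; lra.
    by lra.
  rewrite /= in_itv /= => /andP[ix xs].
  have [y Iy yx] := inf_lt I0 ix.
  have [z Iz xz] := sup_gt I0 xs.
  by apply: (iI _ _ Iy Iz); rewrite !ltW.
Qed.

(** Outer regularity encloses [A] in an open set of Lebesgue measure below [d]. Finitely many of its
    components have total length below [d], so the increments of [G] over them sum to less than [e];
    this bound does not depend on their number and survives the limit. *)
Lemma stieltjes_null (G : cumulative R R) (A : set R) : real_ac G ->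
  measurable A -> A `<=` `]0, 1[ -> mu A = 0%E ->
  lebesgue_stieltjes_measure G A = 0%E.
Proof.
move=> acG mA A01 A0; apply/eqP; rewrite eq_le measure_ge0 andbT.
apply/lee_addgt0Pr => e e0; rewrite add0e.
have [d d0 Hd] := acG _ e0.
have [|U [oU AU Ud]] := @lebesgue_regularity_outer R A d mA _ d0.
  by rewrite [X in (X < _)%E]A0 ltry.
pose V := U `&` `]0, 1[%classic.
have oV : open V by apply: openI => //; exact: interval_open.
have mV : measurable V by exact: open_measurable.
have AV : A `<=` V by move=> x Ax; split; [exact: AU|exact: A01].
have Vd : (mu V < d%:E)%E.
  apply: le_lt_trans Ud; rewrite -[leRHS]adde0 -A0.
  apply: le_trans (measureU2 _ _ _) => //; last first.
    by apply: measurableD => //; exact: open_measurable.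
  rewrite le_measure ?inE//.
    by apply: measurableU => //; apply: measurableD => //; exact: open_measurable.
  move=> x [Ux _]; have [Ax|nAx] := pselect (A x); first by right.
  by left; split.
pose I := open_disjoint_itv oV.
have VI : V = \bigcup_q I q := open_disjoint_itv_bigcup oV.
have oI q : open (I q) by exact: open_disjoint_itv_open.
have mI q : measurable (I q) by exact: open_measurable.
have tI : trivIset [set: nat] I by exact: open_disjoint_itv_trivIset.
have /choice[ab Hab] : forall q, exists ab : R * R,
    [/\ 0 <= ab.1, ab.1 <= ab.2, ab.2 <= 1 & I q = `]ab.1, ab.2[%classic].
  move=> q; apply: open_interval_sub01 => //; first exact: open_disjoint_itv_is_interval.
  move=> x Ix; have : V x by rewrite VI; exists q.
  by case.
apply: (@le_trans _ _ (lebesgue_stieltjes_measure G V)).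
  by rewrite le_measure ?inE.
rewrite VI measure_semi_bigcup//; last by rewrite -VI.
apply: lime_le; first by apply: is_cvg_nneseries => n _ _; exact: measure_ge0.
near=> n.
apply: (@le_trans _ _ (\sum_(0 <= q < n) (G (ab q).2 - G (ab q).1)%:E)%E).
  apply: lee_sum => q _; have [_ le1 _ ->] := Hab q.
  rewrite -lebesgue_stieltjes_oc// le_measure ?inE//.
  exact: subset_itv_oo_oc.
rewrite sumEFin lee_fin big_mkord ltW//.
apply: le_lt_trans (Hd n (fun q : 'I_n => (ab q).1) (fun q : 'I_n => (ab q).2) _ _ _).
- by apply: ler_sum => q _; exact: ler_norm.
- by move=> q; have [] := Hab q.
- apply/trivIsetP => i j _ _ ij; have [_ _ _ <-] := Hab i; have [_ _ _ <-] := Hab j.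
  by move/trivIsetP: tI; apply.
- rewrite -lte_fin; apply: le_lt_trans Vd.
  rewrite VI measure_semi_bigcup//; last by rewrite -VI.
  apply: le_trans (nneseries_lim_ge n _); last by move=> *; exact: measure_ge0.
  rewrite big_mkord -sumEFin; apply: lee_sum => q _.
  have [_ le1 _ Iq] := Hab q.
  have -> : ((ab q).2 - (ab q).1)%:E = mu (I q).
    rewrite Iq lebesgue_measure_itv /= lte_fin.
    by case: ltgtP le1 => // -> _; rewrite subrr.
  exact: lexx.
Unshelve. all: by end_near. Qed.

(** Densities are read off on half-open intervals, so the point 1 has to be included. It has no mass
    because [G] is continuous there from the left. *)
Lemma stieltjes_null_oc (G : cumulative R R) (A : set R) : real_ac G ->
  measurable A -> A `<=` `]0, 1] -> mu A = 0%E ->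
  lebesgue_stieltjes_measure G A = 0%E.
Proof.
move=> acG mA A01 A0.
have G1 : lebesgue_stieltjes_measure G [set 1] = 0%E.
  apply/eqP; rewrite eq_le measure_ge0 andbT; apply/lee_addgt0Pr => e e0.
  rewrite add0e; have [d d0 Hd] := real_ac_dist acG e0.
  pose h := Num.min (d / 2) 1.
  have h0 : 0 < h by rewrite lt_min divr_gt0//= ltr01.
  have h1 : h <= 1 by rewrite ge_min lexx orbT.
  have hd : h < d by rewrite gt_min; apply/orP; left; lra.
  apply: (@le_trans _ _ (lebesgue_stieltjes_measure G `]1 - h, 1])).
    rewrite le_measure ?inE//.
    by move=> x /= ->; rewrite in_itv /= lexx andbT; lra.
  rewrite lebesgue_stieltjes_oc ?lee_fin; last by lra.
  apply: ltW; apply: le_lt_trans (ler_norm _) (Hd _ _ _ _ _ _); lra.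
apply/eqP; rewrite eq_le measure_ge0 andbT.
have mB : measurable (A `&` `]0, 1[%classic) by exact: measurableI.
apply: (@le_trans _ _ (lebesgue_stieltjes_measure G ((A `&` `]0, 1[%classic) `|` [set 1]))).
  rewrite le_measure ?inE//; first exact: measurableU.
  move=> x Ax; have := A01 _ Ax; rewrite /= in_itv /= => /andP[x0].
  rewrite le_eqVlt => /orP[/eqP ->|x1]; first by right.
  by left; split => //=; rewrite in_itv /= x0.
apply: le_trans (measureU2 _ _ _) _ => //.
rewrite [X in (_ + X)%E]G1 adde0 [X in (X <= _)%E](stieltjes_null acG mB)//; last first.
  by apply/eqP; rewrite eq_le measure_ge0 andbT -A0 le_measure ?inE.
Qed.

(** The Stieltjes measure of the clamped function, restricted to []0, 1]], is finite and vanishes on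
    Lebesgue null sets. The density is its Radon-Nikodym derivative, evaluated on the intervals []0,
    x]]. *)
Lemma nondecreasing_ac_density (G : R -> R) :
  {homo G : x y / x <= y} -> real_ac G ->
  exists g : R -> R, mu.-integrable setT (EFin \o g) /\
    forall x : R, 0 <= x <= 1 -> G x = G 0 + \int[mu]_(t in `]0, x]) g t.
Proof.
move=> ndG acG.
pose F x := G (clamp01 x).
have ndF : nondecreasing F by move=> x y xy; exact/ndG/clamp01_le.
have rcF : right_continuous F.
  move=> x; apply/cvgrPdist_lt => e e0.
  have [d d0 Hd] := real_ac_dist acG e0.
  near=> y.
  have xy : x <= y by apply: ltW; near: y; exact: nbhs_right_gt.
  have yd : y < x + d by near: y; apply: nbhs_right_lt; rewrite ltrDl.
  rewrite /F distrC; have /andP[a0 _] := clamp01_itv x; have /andP[_ b1] := clamp01_itv y.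
  apply: Hd => //; first exact: clamp01_le.
  by apply: le_lt_trans (clamp01_lip xy) _; lra.
pose FF : cumulative R R := HB.pack F (isCumulative.Build R _ R F ndF rcF).
have FG x : 0 <= x <= 1 -> F x = G x by move=> x01; rewrite /F clamp01_id.
have acF : real_ac FF.
  move=> e /acG[d d0 Hd]; exists d => // n a b ab tI s.
  rewrite (eq_bigr (fun i => `|G (b i) - G (a i)|)); first exact: Hd.
  move=> i _; have [a0 ab1 b1] := ab i.
  by rewrite /FF /= !FG// ?a0 ?b1 ?(le_trans ab1)// (le_trans a0).
have mD : @measurable _ (measurableTypeR R) `]0, 1]%classic by exact: measurable_itv.
have foo : (lebesgue_stieltjes_measure FF `]0%R, 1%R]%classic < +oo)%E.
  by rewrite lebesgue_stieltjes_oc// ltry.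
pose nu : {finite_measure set (measurableTypeR R) -> \bar R} := mfrestr mD foo.
have dom : nu `<< mu.
  apply/null_content_dominatesP => A mA A0.
  apply: (stieltjes_null_oc acF); first exact: measurableI.
    by move=> x [].
  by apply/eqP; rewrite eq_le measure_ge0 andbT -A0 le_measure ?inE//; exact: measurableI.
have [g [g0 gfin ig Hg]] := @radon_nikodym_sigma_finite _ _ R mu nu dom.
have EF : EFin \o (fine \o g) = g by apply/funext => x /=; rewrite fineK.
exists (fine \o g); rewrite EF; split => // x /andP[x0 x1].
have mx : measurable (`]0, x]%classic : set R) by [].
rewrite /Rintegral.
have -> : (\int[mu]_(t in `]0%R, x]) (fine (g t))%:E = nu `]0%R, x]%classic)%E.
  by rewrite Hg//; apply: eq_integral => t _; rewrite fineK.
have -> : nu `]0, x]%classic =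
    lebesgue_stieltjes_measure FF (`]0, x]%classic `&` `]0, 1]%classic) by [].
rewrite setIidl; last first.
  by move=> t /=; rewrite !in_itv /= => /andP[-> tx]; exact: le_trans x1.
rewrite lebesgue_stieltjes_oc//= !FG ?x0//.
  by rewrite addrC subrK.
by rewrite lexx ler01.
Unshelve. all: by end_near. Qed.

Theorem real_ac_FTC f : real_ac f -> exists g : R -> R,
  [/\ mu.-integrable setT (EFin \o g),
      {ae mu, forall t : R, 0 < t < 1 -> is_derive t (1 : R) f (g t)} &
      forall x : R, 0 <= x <= 1 -> f x = f 0 + \int[mu]_(t in `]0, x]) g t].
Proof.
move=> acf.
have acV := real_ac_tv acf; have ndV := tv_fun_nd acf.
pose c := @clamp01 R.
(* [tv_fun] is already clamped; clamping [f] too makes the difference monotone on the whole line. *)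
have acW : real_ac (fun t => tv_fun f t - f (c t)).
  have acfc : real_ac (fun t => - f (c t)).
    apply: (@real_ac_lip _ _ _ 1 acf) => a b a0 ab b1.
    rewrite /c !clamp01_id ?a0 ?b1 ?(le_trans ab)// ?(le_trans a0)//.
    by rewrite mul1r -opprD normrN.
  exact: real_acD acV acfc.
have ndW : {homo (fun t => tv_fun f t - f (c t)) : x y / x <= y}.
  move=> x y xy.
  have E z : tv_fun f z = tv_fun f (c z).
    by rewrite /tv_fun (clamp01_id (clamp01_itv z)).
  have /andP[x0 _] := clamp01_itv x; have /andP[_ y1] := clamp01_itv y.
  have := tv_funB_ge acf x0 (clamp01_le xy) y1.
  rewrite (E x) (E y) => /(le_trans (ler_norm _)); rewrite -/c; lra.
have [g1 [ig1 H1]] := nondecreasing_ac_density ndV acV.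
have [g2 [ig2 H2]] := nondecreasing_ac_density ndW acW.
have ig : mu.-integrable setT (EFin \o (g1 \- g2)).
  by have := integrableB measurableT ig1 ig2; apply: eq_integrable.
have E x : 0 <= x <= 1 -> f x = f 0 + \int[mu]_(t in `]0, x]) (g1 \- g2) t.
  move=> x01; have h1 := H1 _ x01; have h2 := H2 _ x01.
  have mx : measurable (`]0, x]%classic : set R) by [].
  rewrite RintegralB//; [|exact: integrableS ig1|exact: integrableS ig2].
  move: h2; rewrite /c !clamp01_id ?lexx ?ler01//; lra.
exists (g1 \- g2); split => //.
have lg : locally_integrable [set: R] (g1 \- g2).
  by apply: open_integrable_locally => //; exact: openT.
have igy (y : R) : mu.-integrable `]0, y] (EFin \o (g1 \- g2)).
  exact: integrableS ig.
have := @FTC1 R (g1 \- g2) (BRight 0) igy lg => /=.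
apply: filterS; first exact: (ae_filter_ringOfSetsType mu).
move=> t Ht /andP[t0 t1].
have [dF dFE] := Ht t0.
(* The representation of [f] holds on [0,1] only, so the derivative of the indefinite integral
   passes to [f] at interior points. *)
have nE : {near t, (fun x => f 0 + \int[mu]_(t in `]0, x]) (g1 \- g2) t) =1 f}.
  near=> x; rewrite -E//; apply/andP; split; apply: ltW; near: x.
    exact: lt_nbhsr.
  exact: lt_nbhsl.
have := @is_deriveD R R R (cst (f 0)) _ t 1 0 _ (is_derive_cst _ _ _) (DeriveDef dF (erefl _)).
rewrite add0r -derive1E dFE.
apply: near_eq_is_derive => //.
Unshelve. all: by end_near. Qed.

End Stieltjes.

(** * Integrals of functions known only almost everywhere *)

Section AeIntegral.
Import HBNNSimple.
Local Open Scope ereal_scope.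
Context d (T : measurableType d) (R : realType) (mu : {measure set T -> \bar R}).

(** The integral of a nonnegative function is a supremum over the simple functions below it, which
    is monotone whether or not the function is measurable. *)
Lemma ge0_le_integral_nonmeas (D : set T) (f g : T -> \bar R) :
  (forall x, D x -> 0 <= f x) -> (forall x, D x -> f x <= g x) ->
  \int[mu]_(x in D) f x <= \int[mu]_(x in D) g x.
Proof.
move=> f0 fg; rewrite !ge0_integralE//; last first.
  by move=> x Dx; rewrite (le_trans (f0 _ Dx))// fg.
apply: ereal_sup_le => _ [h /= hf <-]; exists h => // x.
apply: le_trans (hf x) _; rewrite !patchE; case: ifPn => //.
by rewrite inE => Dx; exact: fg.
Qed.

(** The norms integrate [deriv01] itself, whose values on a null set are arbitrary, so only the
    comparison function [g] can be assumed measurable. A simple function below [f] is below [g]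
    almost everywhere; conversely the integral of [g] is unchanged when [N] is removed, and off [N]
    it is an integral of [f]. *)
Lemma ge0_ae_eq_integral_nonmeas (D : set T) (f g : T -> \bar R) :
  measurable D -> measurable_fun D g ->
  (forall x, D x -> 0 <= f x) -> (forall x, D x -> 0 <= g x) ->
  {ae mu, forall x, D x -> f x = g x} ->
  \int[mu]_(x in D) f x = \int[mu]_(x in D) g x.
Proof.
move=> mD mg f0 g0 [N [mN N0 subN]].
have fg x : D x -> ~ N x -> f x = g x.
  move=> Dx Nx; apply: contrapT => nfg; apply: Nx; apply: subN => /=.
  by apply/not_implyP.
apply/eqP; rewrite eq_le; apply/andP; split.
  rewrite [leLHS]ge0_integralE//; apply/ge_ereal_sup => _ [h /= hf <-].
  rewrite -integralT_nnsfun [leRHS]integral_mkcond.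
  have mh : measurable_fun [set: T] (EFin \o h).
    by apply/measurable_EFinP; exact: measurable_funP.
  apply: ae_ge0_le_integral => //.
  - by move=> x _; rewrite lee_fin.
  - by move=> x _; rewrite patchE; case: ifPn => //; rewrite inE => /g0.
  - by apply/(measurable_restrictT _ mD).
  - exists N; split => // x /= nh; apply: contrapT => Nx; apply: nh => _.
    apply: le_trans (hf x) _; rewrite !patchE; case: ifPn => //.
    by rewrite inE => Dx; rewrite fg.
rewrite (ge0_negligible_integral mN mD mg)//.
apply: (@le_trans _ _ (\int[mu]_(x in D `\` N) f x)).
  apply: ge0_le_integral_nonmeas; first by move=> x [/g0].
  by move=> x [Dx Nx]; rewrite fg.
rewrite integral_mkcond [leRHS]integral_mkcond; apply: ge0_le_integral_nonmeas.
  by move=> x _; rewrite patchE; case: ifPn => //; rewrite inE => -[/f0].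
move=> x _; rewrite !patchE; case: ifPn => [/set_mem[Dx _]|_].
  by rewrite mem_set.
by case: ifPn => // /set_mem /f0.
Qed.

Lemma ae_eq_integral_nonmeas (D : set T) (f g : T -> \bar R) :
  measurable D -> measurable_fun D g ->
  {ae mu, forall x, D x -> f x = g x} ->
  \int[mu]_(x in D) f x = \int[mu]_(x in D) g x.
Proof.
move=> mD mg /ae_eq_funeposneg[fp fn].
rewrite integralE [RHS]integralE; congr (_ - _);
  apply: ge0_ae_eq_integral_nonmeas => //.
- exact: measurable_funepos.
- exact: measurable_funeneg.
Qed.

End AeIntegral.

(** * Integrals and difference-quotient derivatives on [0,1], up to null sets *)

Section UnitInterval.
Variable R : realType.
Local Notation mu := (@lebesgue_measure R).
Local Notation D := (@unit_itv R).
Implicit Types f g h : R -> R.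

Definition ae01 (P : R -> Prop) := {ae mu, forall t, D t -> P t}.

(** The two endpoints form a null set, so pointwise arguments may be confined to the interior, where
    derivatives are two-sided. *)
Lemma ae01_imp (P Q : R -> Prop) : (forall t, 0 < t < 1 -> P t -> Q t) ->
  ae01 P -> ae01 Q.
Proof.
move=> PQ aeP.
have n1 (x : R) : mu.-negligible [set x].
  by apply/negligibleP => //; exact: lebesgue_measure_set1.
apply: negligibleS (negligibleU aeP (negligibleU (n1 0) (n1 1))).
move=> t /= /not_implyP[Dt nQ].
have [->|t0] := eqVneq t 0; first by right; left.
have [->|t1] := eqVneq t 1; first by right; right.
left => /= H; apply: nQ; apply: PQ (H Dt).
move: Dt; rewrite /unit_itv /= in_itv /= => /andP[a b].
by rewrite !lt_neqAle eq_sym t0 t1 a b.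
Qed.

Lemma ae01_all (P : R -> Prop) : (forall t, 0 < t < 1 -> P t) -> ae01 P.
Proof.
move=> H; apply: (@ae01_imp (fun=> True)); first by move=> t /H.
by apply: aeW.
Qed.

Lemma ae01_and (P Q : R -> Prop) : ae01 P -> ae01 Q -> ae01 (fun t => P t /\ Q t).
Proof.
move=> p q; apply: (@filterS2 _ _ (ae_filter_ringOfSetsType mu) _ _ _ _ p q).
by move=> t Pt Qt Dt; split; [exact: Pt|exact: Qt].
Qed.

Lemma ae01_imp2 (P1 P2 Q : R -> Prop) :
  (forall t, 0 < t < 1 -> P1 t -> P2 t -> Q t) -> ae01 P1 -> ae01 P2 -> ae01 Q.
Proof.
move=> H p1 p2; apply: ae01_imp (ae01_and p1 p2) => t t01 []; exact: H.
Qed.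

Lemma ae01_imp3 (P1 P2 P3 Q : R -> Prop) :
  (forall t, 0 < t < 1 -> P1 t -> P2 t -> P3 t -> Q t) ->
  ae01 P1 -> ae01 P2 -> ae01 P3 -> ae01 Q.
Proof.
move=> H p1 p2 p3; apply: ae01_imp (ae01_and p1 (ae01_and p2 p3)).
by move=> t t01 [? []]; exact: H.
Qed.

Let mD : @measurable _ (measurableTypeR R) D.
Proof. exact: measurable_itv. Qed.

Let muD : mu D = 1%E.
Proof. by rewrite /unit_itv lebesgue_measure_itv /= lte01 sube0. Qed.

(** Lebesgue measurability in the form used by [in_L2]. Derivatives are known only in this sense. *)
Definition ae_meas f := exists2 g, measurable_fun D g & ae01 (fun t => f t = g t).
Definition ae_integrable f :=
  exists2 g, mu.-integrable D (EFin \o g) & ae01 (fun t => f t = g t).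
Definition int01 f := \int[mu]_(t in D) f t.

Lemma ae_integrable_meas f : ae_integrable f -> ae_meas f.
Proof.
by move=> [g /measurable_int/measurable_EFinP mg fg]; exists g.
Qed.

Lemma ae_measD f g : ae_meas f -> ae_meas g -> ae_meas (fun t => f t + g t).
Proof.
move=> [f' mf ff] [g' mg gg]; exists (fun t => f' t + g' t).
  exact: measurable_funD.
by apply: ae01_imp2 ff gg => t _ -> ->.
Qed.

Lemma ae_measM f g : ae_meas f -> ae_meas g -> ae_meas (fun t => f t * g t).
Proof.
move=> [f' mf ff] [g' mg gg]; exists (fun t => f' t * g' t).
  exact: measurable_funM.
by apply: ae01_imp2 ff gg => t _ -> ->.
Qed.

Lemma ae_meas_cst c : ae_meas (fun=> c).
Proof. by exists (fun=> c); [exact: measurable_cst|exact: ae01_all]. Qed.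

Lemma ae_meas_eq f g : ae01 (fun t => f t = g t) -> ae_meas f -> ae_meas g.
Proof.
by move=> fg [f' mf ff]; exists f' => //; apply: ae01_imp2 fg ff => t _ -> ->.
Qed.

Lemma ae_integrable_eq f g :
  ae01 (fun t => f t = g t) -> ae_integrable f -> ae_integrable g.
Proof.
by move=> fg [f' mf ff]; exists f' => //; apply: ae01_imp2 fg ff => t _ -> ->.
Qed.

Lemma integral01_eq f g : ae01 (fun t => f t = g t) -> ae_meas g ->
  (\int[mu]_(t in D) (f t)%:E = \int[mu]_(t in D) (g t)%:E)%E.
Proof.
move=> fg [h mh gh].
have mh' : measurable_fun D (EFin \o h) by exact/measurable_EFinP.
transitivity (\int[mu]_(t in D) (h t)%:E)%E; last apply/esym;
  apply: ae_eq_integral_nonmeas => //.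
- by apply: ae01_imp2 fg gh => t _ -> ->.
- by apply: ae01_imp gh => t _ ->.
Qed.

Lemma int01_eq f g : ae01 (fun t => f t = g t) -> ae_integrable g ->
  int01 f = int01 g.
Proof.
by move=> fg /ae_integrable_meas mg; rewrite /int01 /Rintegral (integral01_eq fg mg).
Qed.

Lemma integral01E f : ae_integrable f ->
  (\int[mu]_(t in D) (f t)%:E = (int01 f)%:E)%E.
Proof.
move=> sf; rewrite /int01 /Rintegral fineK//; case: sf => g ig fg.
rewrite (integral01_eq fg); first exact: integrable_fin_num ig.
exists g; last exact: ae01_all.
by have /measurable_int/measurable_EFinP := ig.
Qed.

Lemma ae_integrable_dom f h : ae_meas f -> ae_integrable h ->
  ae01 (fun t => `|f t| <= h t) -> ae_integrable f.
Proof.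
move=> [f' mf ff] [h' ih hh] fh; exists f' => //.
have mh := measurable_int _ ih.
have mh' : measurable_fun D h' by exact/measurable_EFinP.
pose N t := `|f' t| <= `|h' t|.
have aeN : ae01 N.
  apply: ae01_imp3 ff hh fh => t _ -> -> /le_trans; apply; exact: ler_norm.
apply/integrableP; split; first exact/measurable_EFinP.
have [_ lty] := integrableP _ _ _ ih.
apply: le_lt_trans lty; apply: ae_ge0_le_integral => //.
- by apply/measurable_EFinP; apply: measurableT_comp => //; exact/measurable_EFinP.
- by apply/measurable_EFinP; apply: measurableT_comp => //; exact/measurable_EFinP.
Qed.

Lemma ae_integrableD f g : ae_integrable f -> ae_integrable g ->
  ae_integrable (fun t => f t + g t).
Proof.
move=> [f' mf ff] [g' mg gg]; exists (fun t => f' t + g' t).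
  by have := integrableD mD mf mg; apply: eq_integrable.
by apply: ae01_imp2 ff gg => t _ -> ->.
Qed.

Lemma ae_integrableZ c f : ae_integrable f -> ae_integrable (fun t => c * f t).
Proof.
move=> [f' mf ff]; exists (fun t => c * f' t).
  by have := integrableZl mD c mf; apply: eq_integrable.
by apply: ae01_imp ff => t _ ->.
Qed.

Lemma ae_integrable_cst c : ae_integrable (fun=> c).
Proof.
exists (fun=> c); last exact: ae01_all.
apply: measurable_bounded_integrable => //.
- by rewrite [X in (X < _)%E]muD ltry.
- exact: bounded_cst.
Qed.

Lemma int01D f g : ae_integrable f -> ae_integrable g ->
  int01 (fun t => f t + g t) = int01 f + int01 g.
Proof.
move=> sf sg; have sfg := ae_integrableD sf sg.
have [f' mf ff] := sf; have [g' mg gg] := sg.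
have gd h : mu.-integrable D (EFin \o h) -> ae_integrable h.
  by move=> ih; exists h => //; exact: ae01_all.
rewrite (int01_eq ff (gd _ mf)) (int01_eq gg (gd _ mg)) -[RHS]RintegralD//.
apply: int01_eq; first by apply: ae01_imp2 ff gg => t _ -> ->.
by apply: ae_integrableD; exact: gd.
Qed.

Lemma int01Z c f : ae_integrable f -> int01 (fun t => c * f t) = c * int01 f.
Proof.
move=> sf; have [f' mf ff] := sf.
have gd h : mu.-integrable D (EFin \o h) -> ae_integrable h.
  by move=> ih; exists h => //; exact: ae01_all.
rewrite (int01_eq ff (gd _ mf)) -[RHS]RintegralZl//.
apply: int01_eq; first by apply: ae01_imp ff => t _ ->.
by apply: ae_integrableZ; exact: gd.
Qed.

Lemma int01_ge0 f : (forall t, 0 <= f t) -> 0 <= int01 f.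
Proof. by move=> f0; apply: Rintegral_ge0. Qed.

Lemma int01_cst c : int01 (fun=> c) = c.
Proof.
by rewrite /int01 Rintegral_cst// [X in fine X]muD mulr1.
Qed.

Lemma int01_le f g : ae_integrable f -> ae_integrable g ->
  (forall t, f t <= g t) -> int01 f <= int01 g.
Proof.
move=> sf sg fg; rewrite -subr_ge0 -mulN1r -int01Z// -int01D//; last exact: ae_integrableZ.
by apply: int01_ge0 => t; rewrite mulN1r subr_ge0.
Qed.

Lemma int01_eq0 f : ae_integrable f -> (forall t, 0 <= f t) -> int01 f = 0 ->
  ae01 (fun t => f t = 0).
Proof.
move=> sf f0 I0; have [g ig fg] := sf.
have mg := measurable_int _ ig.
have E : (\int[mu]_(t in D) `|(EFin \o g) t| = 0)%E.
  rewrite -[RHS]/(0%:E) -I0 -integral01E//.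
  apply/esym; apply: ae_eq_integral_nonmeas => //.
    exact: measurableT_comp.
  by apply: ae01_imp fg => t _ ft /=; rewrite -ft ger0_norm.
have := ae_eq_integral_abs mu mD mg; rewrite E => -[/(_ erefl) H _].
apply: ae01_imp2 fg _; last exact: H.
by move=> t _ -> /= -[].
Qed.

Lemma real_derive_carat f (t l : R) : is_derive t (1 : R) f l ->
  (s - t)^-1 * (f s - f t) @[s --> t^'] --> l.
Proof.
move=> /is_derive1_caratheodory[g [fE cg <-]].
have : g s @[s --> t^'] --> g t by apply: cvg_within_filter; exact: cg.
apply: cvg_trans; apply: near_eq_cvg; near=> s.
rewrite fE mulrC -mulrA divff ?mulr1// subr_eq0.
near: s; exact: nbhs_dnbhs_neq.
Unshelve. all: by end_near. Qed.

(** Properness makes the limit defining [deriv01_real] unique. Each half of the interval leaves room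
    on the opposite side: points to the right of [t] serve when [t <= 1 / 2], points to the left
    otherwise. *)
Lemma within01_proper (t : R) : D t -> ProperFilter (within D t^').
Proof.
rewrite /unit_itv /= in_itv /= => /andP[t0 t1].
apply: Build_ProperFilter_ex => P [e /= e0 He].
pose h := Num.min (e / 2) (1 / 2).
have h0 : 0 < h by rewrite lt_min !divr_gt0.
have he : h < e by rewrite gt_min; apply/orP; left; lra.
have h1 : h <= 1 / 2 by rewrite ge_min lexx orbT.
have [tl|tl] := lerP t (1 / 2).
  exists (t + h); apply: He => /=; rewrite ?opprD ?addNKr ?normrN ?gtr0_norm//.
    by apply/eqP; lra.
  by rewrite /unit_itv /= in_itv /=; apply/andP; split; lra.
exists (t - h); apply: He => /=.
    by rewrite opprB addrC subrK gtr0_norm.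
  by apply/eqP; lra.
by rewrite /unit_itv /= in_itv /=; apply/andP; split; lra.
Qed.

Lemma deriv01_realE f (t l : R) : D t -> is_derive t (1 : R) f l ->
  deriv01_real f t = l.
Proof.
move=> Dt /real_derive_carat H; apply: cvg_lim => //.
  exact: within01_proper.
exact: cvg_within_filter.
Qed.

Lemma eq_deriv01_real f g (t : R) : D t -> (forall s, D s -> f s = g s) ->
  deriv01_real f t = deriv01_real g t.
Proof.
move=> Dt fg; rewrite /deriv01_real.
have E : (s - t)^-1 * (f s - f t) @[s --> within D t^'] =
    (s - t)^-1 * (g s - g t) @[s --> within D t^'].
  by apply/seteqP; split; apply: near_eq_cvg; rewrite near_withinE;
    apply: nearW => s Ds; rewrite !fg.
by rewrite E.
Qed.

End UnitInterval.

(** * Calculus rules for absolutely continuous real functions *)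

Section RealCalculus.
Variable R : realType.
Local Notation mu := (@lebesgue_measure R).
Local Notation D := (@unit_itv R).
Implicit Types f g h : R -> R.

Lemma unit_itvP (t : R) : D t <-> 0 <= t <= 1.
Proof. by rewrite /unit_itv /= in_itv. Qed.

Lemma int01_le_ae f g : ae_integrable f -> ae_integrable g ->
  ae01 (fun t => f t <= g t) -> int01 f <= int01 g.
Proof.
move=> sf sg fg; rewrite -subr_ge0 -mulN1r -int01Z// -int01D//; last exact: ae_integrableZ.
have sd := ae_integrableD sg (ae_integrableZ (-1) sf).
rewrite -(@int01_eq _ (fun t => `|g t + -1 * f t|)) //.
  by apply: int01_ge0 => t.
by apply: ae01_imp fg => t _ fgt; rewrite ger0_norm// mulN1r subr_ge0.
Qed.

(** Transfers the density to [deriv01_real], which equals it wherever [f] is differentiable with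
    that derivative. The last clause is the uniqueness principle for the first-order equations; it
    separates absolute continuity from mere bounded variation, as the Cantor function shows. *)
Lemma real_ac_deriv f : real_ac f -> [/\ ae_integrable (deriv01_real f),
  ae01 (fun t => is_derive t (1 : R) f (deriv01_real f t)),
  int01 (deriv01_real f) = f 1 - f 0 &
  ae01 (fun t => deriv01_real f t = 0) -> forall t, 0 <= t <= 1 -> f t = f 0].
Proof.
move=> acf; have [g [ig dg Eg]] := real_ac_FTC acf.
have aed : ae01 (fun t => is_derive t (1 : R) f (g t)).
  apply: (@ae01_imp _ (fun t => 0 < t < 1 -> is_derive t (1 : R) f (g t))).
    by move=> t t01; exact.
  apply: (@filterS _ _ (ae_filter_ringOfSetsType mu) _ _ _ dg) => t Ht _; exact: Ht.
have aeE : ae01 (fun t => deriv01_real f t = g t).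
  apply: ae01_imp aed => t /andP[t0 t1] H; apply: deriv01_realE => //.
  by apply/unit_itvP; rewrite !ltW.
have iD : mu.-integrable D (EFin \o g).
  by apply: integrableS ig => //; exact: measurable_itv.
have sg : ae_integrable g by exists g => //; exact: ae01_all.
have mE (x : R) : measurable_fun `]0, x] g.
  by apply: measurable_funTS; have /measurable_int/measurable_EFinP := ig.
split.
- by exists g.
- by apply: ae01_imp2 aed aeE => t _ H ->.
- rewrite (int01_eq aeE sg) (Eg 1) ?ler01 ?lexx// addrC addKr.
  rewrite /int01 /unit_itv -Rintegral_itv_obnd_cbnd//.
  by apply: integrableS ig => //; exact: measurable_itv.
- move=> z t /andP[t0 t1]; rewrite Eg ?t0// [X in _ + X](_ : _ = 0) ?addr0//.
  rewrite /Rintegral (@ae_eq_integral_nonmeas _ _ _ _ _ _ (cst 0%E))//.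
  + by rewrite integral0.
  + have g0 : ae01 (fun s => g s = 0) by apply: ae01_imp2 aeE z => s _ ->.
    apply: (@filterS _ _ (ae_filter_ringOfSetsType mu) _ _ _ g0) => s Hs /= s0t.
    rewrite Hs//; apply/unit_itvP.
    by move: s0t; rewrite in_itv /= => /andP[/ltW -> /le_trans]; apply.
Qed.

Lemma real_ac_derivable f : real_ac f ->
  ae01 (fun t => is_derive t (1 : R) f (deriv01_real f t)).
Proof. by case/real_ac_deriv. Qed.

Lemma deriv01_real_oo f (t l : R) : 0 < t < 1 -> is_derive t (1 : R) f l ->
  deriv01_real f t = l.
Proof.
by move=> /andP[t0 t1]; apply: deriv01_realE; apply/unit_itvP; rewrite !ltW.
Qed.

Lemma deriv01_realD f g : real_ac f -> real_ac g ->
  ae01 (fun t => deriv01_real (fun t => f t + g t) t = deriv01_real f t + deriv01_real g t).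
Proof.
move=> /real_ac_derivable df /real_ac_derivable dg.
by apply: ae01_imp2 df dg => t t01 df dg; apply: deriv01_real_oo t01 (is_deriveD df dg).
Qed.

Lemma deriv01_realM f g : real_ac f -> real_ac g ->
  ae01 (fun t => deriv01_real (fun t => f t * g t) t =
                 deriv01_real f t * g t + f t * deriv01_real g t).
Proof.
move=> /real_ac_derivable df /real_ac_derivable dg.
apply: ae01_imp2 df dg => t t01 df dg.
rewrite (deriv01_real_oo t01 (is_deriveM df dg)) addrC mulrC.
by congr (_ + _).
Qed.

(** A continuous derivative is bounded on [0,1], so by the mean value theorem [f] is Lipschitz
    there. *)
Lemma real_ac_smooth f (f' : R -> R) :
  (forall t, is_derive t (1 : R) f (f' t)) -> continuous f' -> real_ac f.
Proof.
move=> df cf'.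
have [M [_ hM]] : bounded_set (f' @` `[0, 1]%classic).
  apply: compact_bounded; apply: continuous_compact; last exact: segment_compact.
  exact: continuous_subspaceT.
apply: (@real_ac_lip R id f (M + 1) (@real_ac_id R)) => a b a0 ab b1.
have [c c01 ->] : exists2 c, c \in `[a, b] & f b - f a = f' c * (b - a).
  apply: (MVT_segment ab (fun x _ => df x)).
  apply: continuous_subspaceT => x.
  exact/differentiable_continuous/derivable1_diffP.
rewrite normrM ler_wpM2r//; apply: (hM (M + 1)); first by rewrite ltrDl.
exists c => //=; move: c01; rewrite !in_itv /= => /andP[ac cb].
by rewrite (le_trans a0)// (le_trans cb).
Qed.

Lemma real_ac_cst c : real_ac (fun=> c : R).
Proof.
by apply: (@real_ac_smooth _ (fun=> 0)) => x; exact: cvg_cst.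
Qed.

(** The clamped function is continuous on the whole line, hence Borel, and agrees with [f] on
    [0,1]. *)
Lemma real_ac_ae_meas f : real_ac f -> ae_meas f.
Proof.
move=> acf; exists (f \o @clamp01 R).
  apply: measurable_funTS; apply: continuous_measurable_fun => x.
  apply/cvgrPdist_lt => e e0; have [d d0 Hd] := real_ac_dist acf e0.
  exists d => //= y xy.
  have /andP[x0 x1] := clamp01_itv x; have /andP[y0 y1] := clamp01_itv y.
  have [le_xy|/ltW le_yx] := leP x y.
    rewrite distrC; apply: Hd => //; first exact: clamp01_le.
    apply: le_lt_trans (clamp01_lip le_xy) _.
    by apply: le_lt_trans xy; rewrite distrC ler_norm.
  apply: Hd => //; first exact: clamp01_le.
  apply: le_lt_trans (clamp01_lip le_yx) _.
  by apply: le_lt_trans xy; rewrite ler_norm.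
apply: ae01_all => t /andP[t0 t1] /=; rewrite clamp01_id// !ltW//.
Qed.

Lemma real_ac_integrable f : real_ac f -> ae_integrable f.
Proof.
move=> acf; have [M HM] := real_ac_bounded acf.
apply: (@ae_integrable_dom _ _ (fun=> M)).
- exact: real_ac_ae_meas.
- exact: ae_integrable_cst.
- by apply: ae01_all => t /andP[t0 t1]; apply: HM; rewrite !ltW.
Qed.

End RealCalculus.

(** * Complex-valued functions on the unit interval *)

Section ComplexCalculus.
Variable R : realType.
Local Notation D := (@unit_itv R).
Local Notation Re := complex.Re.
Local Notation Im := complex.Im.
Implicit Types u v q : R -> R[i].

(** The Euclidean inner product of the plane, that is the real part of [z * conjc w]. It keeps all
    integrals and series of pairings real. *)
Definition ip (z w : R[i]) : R := Re z * Re w + Im z * Im w.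

Lemma normc_sqr (z : R[i]) : normc z ^+ 2 = ip z z.
Proof.
by case: z => a c; rewrite /ip /= sqr_sqrtr ?addr_ge0 ?sqr_ge0// !expr2.
Qed.

Lemma ip_ge0 z : 0 <= ip z z.
Proof. by rewrite -normc_sqr sqr_ge0. Qed.

Lemma ip_eq0 z : ip z z = 0 -> z = 0.
Proof.
by move=> /eqP; rewrite -normc_sqr sqrf_eq0 => /eqP; exact: eq0_normc.
Qed.

Lemma ReD (z w : R[i]) : Re (z + w) = Re z + Re w.
Proof. by case: z; case: w. Qed.
Lemma ImD (z w : R[i]) : Im (z + w) = Im z + Im w.
Proof. by case: z; case: w. Qed.
Lemma ReM (z w : R[i]) : Re (z * w) = Re z * Re w - Im z * Im w.
Proof. by case: z; case: w. Qed.
Lemma ImM (z w : R[i]) : Im (z * w) = Re z * Im w + Im z * Re w.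
Proof. by case: z; case: w. Qed.
Lemma ReN (z : R[i]) : Re (- z) = - Re z. Proof. by case: z. Qed.
Lemma ImN (z : R[i]) : Im (- z) = - Im z. Proof. by case: z. Qed.
Lemma Rer (x : R) : Re x%:C = x. Proof. by []. Qed.
Lemma Imr (x : R) : Im x%:C = 0. Proof. by []. Qed.
Lemma Re_conj (z : R[i]) : Re (conjc z) = Re z. Proof. by case: z. Qed.
Lemma Im_conj (z : R[i]) : Im (conjc z) = - Im z. Proof. by case: z. Qed.
Definition ReImE := (ReD, ImD, ReM, ImM, ReN, ImN, Rer, Imr, Re_conj, Im_conj).

Lemma complex_eq (z w : R[i]) : Re z = Re w -> Im z = Im w -> z = w.
Proof. by case: z => a b; case: w => c d /= -> ->. Qed.

Lemma ip_le z w : `|ip z w| <= (ip z z + ip w w) / 2.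
Proof.
rewrite ler_norml /ip; apply/andP; split; rewrite -subr_ge0.
  have := addr_ge0 (sqr_ge0 (Re z + Re w)) (sqr_ge0 (Im z + Im w)).
  by rewrite !expr2; lra.
have := addr_ge0 (sqr_ge0 (Re z - Re w)) (sqr_ge0 (Im z - Im w)).
by rewrite !expr2; lra.
Qed.

Lemma ipD_le z w : ip (z + w) (z + w) <= 2 * ip z z + 2 * ip w w.
Proof.
rewrite /ip !ReImE -subr_ge0.
have := addr_ge0 (sqr_ge0 (Re z - Re w)) (sqr_ge0 (Im z - Im w)).
by rewrite !expr2; lra.
Qed.

Lemma ipM_sqr z w : ip (z * w) (z * w) = ip z z * ip w w.
Proof. by rewrite -!normc_sqr normcM exprMn. Qed.

(** Multiplication by [conjc b] is the adjoint of multiplication by [b]; this is where the conjugate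
    in the equation for [q_j] comes from. *)
Lemma ipM_conj b z w : ip (b * z) w = ip z (conjc b * w).
Proof. by rewrite /ip !ReImE; ring. Qed.

Lemma ip_sqrD z w : ip (z + w) (z + w) = ip z z + ip w w + 2 * ip z w.
Proof. by rewrite /ip !ReImE; ring. Qed.

Lemma ipDl z z' w : ip (z + z') w = ip z w + ip z' w.
Proof. by rewrite /ip !ReImE; ring. Qed.

(** The modulus dominates both components and is dominated by the sum of their absolute values. *)
Lemma abs_cont01E u : abs_cont01 u <->
  real_ac (fun t => Re (u t)) /\ real_ac (fun t => Im (u t)).
Proof.
have nR (z : R[i]) : `|Re z| <= normc z.
  case: z => a c /=; rewrite -[leLHS]sqrtr_sqr ler_wsqrtr// lerDl sqr_ge0//.
have nI (z : R[i]) : `|Im z| <= normc z.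
  case: z => a c /=; rewrite -[leLHS]sqrtr_sqr ler_wsqrtr// lerDr sqr_ge0//.
have nC (z : R[i]) : normc z <= `|Re z| + `|Im z|.
  rewrite -[leRHS]ger0_norm ?addr_ge0// -[leRHS]sqrtr_sqr; case: z => a c /=.
  rewrite ler_wsqrtr// sqrrD !real_normK ?num_real// addrAC lerDl.
  by rewrite mulrn_wge0// mulr_ge0.
split=> [acu|[acr aci]].
  split=> e /acu[d d0 Hd]; exists d => // n a b ab tI s;
    apply: le_lt_trans (Hd _ _ _ ab tI s); apply: ler_sum => i _.
    by rewrite -ReN -ReD; exact: nR.
  by rewrite -ImN -ImD; exact: nI.
move=> e e0; have e2 : 0 < e / 2 by rewrite divr_gt0.
have [d1 d10 H1] := acr _ e2; have [d2 d20 H2] := aci _ e2.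
exists (Num.min d1 d2); first by rewrite lt_min d10.
move=> n a b ab tI; rewrite lt_min => /andP[s1 s2].
have h1 := H1 _ _ _ ab tI s1; have h2 := H2 _ _ _ ab tI s2.
rewrite [e]splitr; apply: le_lt_trans (ltrD h1 h2); rewrite -big_split /=.
apply: ler_sum => i _; apply: le_trans (nC _) _.
by rewrite !ReImE.
Qed.

Lemma abs_cont01_eq u v : (forall t, 0 <= t <= 1 -> u t = v t) ->
  abs_cont01 u -> abs_cont01 v.
Proof.
move=> uv acu e /acu[d d0 Hd]; exists d => // n a b ab tI s.
have := Hd _ _ _ ab tI s; congr (_ < _); apply: eq_bigr => i _.
by have [a0 ab1 b1] := ab i; rewrite !uv// ?a0 ?b1 ?(le_trans ab1)// (le_trans a0).
Qed.

Lemma abs_cont01D u v : abs_cont01 u -> abs_cont01 v ->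
  abs_cont01 (fun t => u t + v t).
Proof.
move=> /abs_cont01E[ur ui] /abs_cont01E[vr vi]; apply/abs_cont01E; split.
  rewrite (_ : (fun _ => _) = (fun t => Re (u t) + Re (v t))).
    exact: (real_acD ur vr).
  by apply/funext => t; rewrite ReD.
rewrite (_ : (fun _ => _) = (fun t => Im (u t) + Im (v t))).
  exact: (real_acD ui vi).
by apply/funext => t; rewrite ImD.
Qed.

Lemma abs_cont01Z c u : abs_cont01 u -> abs_cont01 (fun t => c * u t).
Proof.
move=> /abs_cont01E[ur ui]; apply/abs_cont01E; split.
  rewrite (_ : (fun _ => _) = (fun t => Re c * Re (u t) + - Im c * Im (u t))).
    exact: (real_acD (real_acZ (Re c) ur) (real_acZ (- Im c) ui)).
  by apply/funext => t; rewrite ReM mulNr.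
rewrite (_ : (fun _ => _) = (fun t => Re c * Im (u t) + Im c * Re (u t))).
  exact: (real_acD (real_acZ (Re c) ui) (real_acZ (Im c) ur)).
by apply/funext => t; rewrite ImM.
Qed.

Lemma eq_deriv01 u v t : 0 <= t <= 1 -> (forall s, 0 <= s <= 1 -> u s = v s) ->
  deriv01 u t = deriv01 v t.
Proof.
move=> /unit_itvP Dt uv; rewrite /deriv01; congr (_ +i* _);
  by apply: eq_deriv01_real => // s /unit_itvP /uv ->.
Qed.

Lemma deriv01D u v : abs_cont01 u -> abs_cont01 v ->
  ae01 (fun t => deriv01 (fun t => u t + v t) t = deriv01 u t + deriv01 v t).
Proof.
move=> /abs_cont01E[ur ui] /abs_cont01E[vr vi].
apply: ae01_imp2 (deriv01_realD ur vr) (deriv01_realD ui vi) => t _ er ei.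
apply: complex_eq; rewrite /= -?er -?ei; congr (deriv01_real _ t);
  by apply/funext => s; rewrite ?ReD ?ImD.
Qed.

Lemma deriv01Z c u : abs_cont01 u ->
  ae01 (fun t => deriv01 (fun t => c * u t) t = c * deriv01 u t).
Proof.
move=> /abs_cont01E[ur ui].
have r1 := real_ac_derivable ur; have i1 := real_ac_derivable ui.
apply: ae01_imp2 r1 i1 => t t01 dr di.
apply: complex_eq; rewrite /= !ReImE /=; apply: (deriv01_real_oo t01).
  have := is_deriveB (is_deriveZ (Re c) dr) (is_deriveZ (Im c) di).
  by congr is_derive; apply/funext => s; rewrite ReM.
have := is_deriveD (is_deriveZ (Re c) di) (is_deriveZ (Im c) dr).
by congr is_derive; apply/funext => s; rewrite ImM.
Qed.

Lemma real_ac_ip u v : abs_cont01 u -> abs_cont01 v ->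
  real_ac (fun t => ip (u t) (v t)).
Proof.
move=> /abs_cont01E[ur ui] /abs_cont01E[vr vi].
by apply: real_acD; exact: real_acM.
Qed.

Lemma deriv01_ip u v : abs_cont01 u -> abs_cont01 v ->
  ae01 (fun t => deriv01_real (fun t => ip (u t) (v t)) t =
                 ip (deriv01 u t) (v t) + ip (u t) (deriv01 v t)).
Proof.
move=> /abs_cont01E[ur ui] /abs_cont01E[vr vi].
apply: ae01_imp3 (deriv01_realD (real_acM ur vr) (real_acM ui vi))
  (deriv01_realM ur vr) (deriv01_realM ui vi) => t _ E Er Ei.
by rewrite [LHS]E Er Ei /ip /=; ring.
Qed.

Lemma in_L2P u : in_L2 u <-> [/\ ae_meas (fun t => Re (u t)),
  ae_meas (fun t => Im (u t)) & ae_integrable (fun t => ip (u t) (u t))].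
Proof.
split=> [[[g [mr mi ug]] fin]|[[gr mr er] [gi mi ei] iu]].
  have E1 : ae_meas (fun t => Re (u t)).
    by exists (fun t => Re (g t)) => //; apply: ae01_imp ug => t _ ->.
  have E2 : ae_meas (fun t => Im (u t)).
    by exists (fun t => Im (g t)) => //; apply: ae01_imp ug => t _ ->.
  split=> //; exists (fun t => ip (g t) (g t)); last first.
    by apply: ae01_imp ug => t _ ->.
  have mg : measurable_fun D (fun t => ip (g t) (g t)).
    by apply: measurable_funD; exact: measurable_funM.
  apply/integrableP; split; first exact/measurable_EFinP.
  move: fin; rewrite /sqnorm_L2; congr (_ < _)%E.
  apply: ae_eq_integral_nonmeas => //; first exact: measurable_itv.
    by apply: measurableT_comp => //; exact/measurable_EFinP.
  apply: ae01_imp ug => t _ ->; rewrite /= ger0_norm ?ip_ge0// normc_sqr//.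
split.
  exists (fun t => gr t +i* gi t); split => //.
  by apply: ae01_imp2 er ei => t _ a b; apply: complex_eq.
rewrite /sqnorm_L2 (_ : (fun _ => _) = (fun t => (ip (u t) (u t))%:E)); last first.
  by apply/funext => t; rewrite normc_sqr.
by rewrite integral01E// ltry.
Qed.

Lemma sqnorm_L2E u : in_L2 u -> sqnorm_L2 u = (int01 (fun t => ip (u t) (u t)))%:E.
Proof.
move=> /in_L2P[_ _ iu]; rewrite -integral01E// /sqnorm_L2.
by congr integral; apply/funext => t; rewrite normc_sqr.
Qed.

Lemma in_L2_eq u v : ae01 (fun t => u t = v t) -> in_L2 u -> in_L2 v.
Proof.
move=> uv /in_L2P[r i iu]; apply/in_L2P; split.
- by apply: ae_meas_eq r; apply: ae01_imp uv => t _ ->.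
- by apply: ae_meas_eq i; apply: ae01_imp uv => t _ ->.
- by apply: ae_integrable_eq iu; apply: ae01_imp uv => t _ ->.
Qed.

Lemma in_L2_ip u v : in_L2 u -> in_L2 v -> ae_integrable (fun t => ip (u t) (v t)).
Proof.
move=> /in_L2P[ur ui iu] /in_L2P[vr vi iv].
apply: (@ae_integrable_dom _ _ (fun t => 2^-1 * (ip (u t) (u t) + ip (v t) (v t)))).
- by apply: ae_measD; exact: ae_measM.
- by apply: ae_integrableZ; exact: ae_integrableD.
- by apply: ae01_all => t _; rewrite mulrC; exact: ip_le.
Qed.

Lemma in_L2D u v : in_L2 u -> in_L2 v -> in_L2 (fun t => u t + v t).
Proof.
move=> uL vL; have /in_L2P[ur ui iu] := uL; have /in_L2P[vr vi iv] := vL.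
apply/in_L2P; split.
- by under [X in ae_meas X]eq_fun do rewrite ReD; exact: ae_measD.
- by under [X in ae_meas X]eq_fun do rewrite ImD; exact: ae_measD.
- under [X in ae_integrable X]eq_fun do rewrite ip_sqrD.
  apply: ae_integrableD; first exact: ae_integrableD.
  by apply: ae_integrableZ; exact: in_L2_ip.
Qed.

Lemma in_L2Z c u : in_L2 u -> in_L2 (fun t => c * u t).
Proof.
move=> /in_L2P[ur ui iu]; apply/in_L2P; split.
- under [X in ae_meas X]eq_fun do rewrite ReM -mulNr.
  by apply: ae_measD; apply: ae_measM => //; exact: ae_meas_cst.
- under [X in ae_meas X]eq_fun do rewrite ImM.
  by apply: ae_measD; apply: ae_measM => //; exact: ae_meas_cst.
- by under [X in ae_integrable X]eq_fun do rewrite ipM_sqr; exact: ae_integrableZ.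
Qed.

Lemma abs_cont01_L2 u : abs_cont01 u -> in_L2 u.
Proof.
move=> acu; have /abs_cont01E[ur ui] := acu; apply/in_L2P; split.
- exact: real_ac_ae_meas.
- exact: real_ac_ae_meas.
- by apply: real_ac_integrable; exact: real_ac_ip.
Qed.

(** The integrand is the derivative of [ip (u t) (q t)]: by adjointness the term with [conjc b * q]
    turns into the term with [b * u]. *)
Lemma green_edge b u q : abs_cont01 u -> abs_cont01 q ->
  ae01 (fun t => deriv01 q t = conjc b * q t) ->
  int01 (fun t => ip (deriv01 u t + b * u t) (q t)) =
  ip (u 1) (q 1) - ip (u 0) (q 0).
Proof.
move=> acu acq qE.
have [sI _ <- _] := real_ac_deriv (real_ac_ip acu acq).
apply: int01_eq => //; apply: ae01_imp2 qE (deriv01_ip acu acq) => t _ qt ->.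
by rewrite ipDl qt ipM_conj.
Qed.

Definition sqint u : R := int01 (fun t => ip (u t) (u t)).

(** Integrate the derivative of [s t * ip (u t) (u t)] for an affine [s] with slope 1 and modulus at
    most 1 that vanishes at the opposite end: [s t = t] isolates the value at 1, [s t = -1 + t] the
    value at 0. *)
Lemma trace_le u : abs_cont01 u -> in_L2 (deriv01 u) ->
  ip (u 1) (u 1) <= 2 * sqint u + sqint (deriv01 u) /\
  ip (u 0) (u 0) <= 2 * sqint u + sqint (deriv01 u).
Proof.
move=> acu duL; set N := 2 * _ + _; have acuu := real_ac_ip acu acu.
have iu := real_ac_integrable acuu.
have /in_L2P[_ _ idu] := duL.
pose n t := ip (u t) (u t); pose dn t := ip (deriv01 u t) (deriv01 u t).
have iN : ae_integrable (fun t => 2 * n t + dn t).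
  by apply: ae_integrableD => //; exact: ae_integrableZ.
have NE : int01 (fun t => 2 * n t + dn t) = N.
  by rewrite int01D ?int01Z//; exact: ae_integrableZ.
have cs t : `|ip (deriv01 u t) (u t) + ip (u t) (deriv01 u t)| <= n t + dn t.
  apply: le_trans (ler_normD _ _) _.
  have := ip_le (deriv01 u t) (u t); have := ip_le (u t) (deriv01 u t).
  by rewrite /n /dn; lra.
(* The integrand is [w * n] plus [s] times the derivative of [n]; the first is at most [n], the
   second at most [n + dn], which accounts for the factor 2. *)
have key (w : R) (s : R -> R) : real_ac s -> (forall t, 0 < t < 1 -> `|s t| <= 1) ->
    ae01 (fun t => deriv01_real s t = w) -> `|w| <= 1 ->
    s 1 * n 1 - s 0 * n 0 <= N.
  move=> acs s1 ds w1; have acF := real_acM acs acuu.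
  have [sI _ <- _] := real_ac_deriv acF.
  rewrite -NE; apply: int01_le_ae => //.
  apply: ae01_imp3 (deriv01_realM acs acuu) (deriv01_ip acu acu) ds => t t01 -> -> ->.
  have := cs t; have := s1 _ t01; have n0 : 0 <= n t by exact: ip_ge0.
  rewrite -/(n t); move=> st; set X := _ + ip _ _ => cX.
  have h1 : w * n t <= n t.
    by rewrite ler_piMl// (le_trans (ler_norm _)).
  have h2 : s t * X <= n t + dn t.
    apply: le_trans (ler_norm _) _; rewrite normrM.
    by apply: le_trans (ler_piMl _ _) cX.
  lra.
split.
  have := key 1 id (@real_ac_id R); rewrite mul1r mul0r subr0; apply.
  - by move=> t /andP[t0 t1]; rewrite gtr0_norm// ltW.
  - by apply: ae01_all => t t01; apply: deriv01_real_oo t01 _.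
  - by rewrite normr1.
have acs : real_ac (fun t : R => -1 + t) by apply: real_acD; [exact: real_ac_cst|exact: (@real_ac_id R)].
have := key 1 _ acs => /=; rewrite addNr mul0r addr0 sub0r mulN1r opprK; apply.
- by move=> t /andP[t0 t1]; rewrite ler0_norm; lra.
- apply: ae01_all => t t01; apply: deriv01_real_oo t01 _.
  rewrite -[X in is_derive _ _ _ X]add0r.
  by apply: is_deriveD.
- by rewrite normr1.
Qed.

(** The derivative of the squared modulus of [u] is [- 2 * Re b] times itself, so the integrating
    factor [e] makes the product constant, and it vanishes at 0. *)
Lemma homogeneous_zero b u : abs_cont01 u -> u 0 = 0 ->
  ae01 (fun t => deriv01 u t + b * u t = 0) -> forall t, 0 <= t <= 1 -> u t = 0.
Proof.
move=> acu u0 uE t t01.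
pose c := 2 * Re b; pose e (s : R) := expR (c * s).
have de s : is_derive s (1 : R) e (expR (c * s) * c).
  apply: (@is_derive1_comp _ expR ( *%R c)).
  have := @is_deriveZ R R R id c s 1 1 (is_derive_id _ _).
  by rewrite [c *: 1]mulr1.
have ce : continuous (fun s : R => expR (c * s) * c).
  move=> s; apply: cvgM; last exact: cvg_cst.
  suff : {for s, continuous e} by [].
  by apply: differentiable_continuous; apply/derivable1_diffP; have [] := de s.
have ace : real_ac e by exact: real_ac_smooth de ce.
have acuu := real_ac_ip acu acu.
have acF := real_acM ace acuu.
have [_ _ _ H] := real_ac_deriv acF.
have : e t * ip (u t) (u t) = e 0 * ip (u 0) (u 0).
  apply: H => //.
  apply: ae01_imp3 uE (deriv01_realM ace acuu) (deriv01_ip acu acu) => s s01 us -> ->.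
  rewrite (deriv01_real_oo s01 (de s)) -/(e s).
  have -> : deriv01 u s = - (b * u s) by apply/eqP; rewrite -addr_eq0 us.
  by rewrite /ip /c !ReImE; ring.
rewrite u0 [X in _ = _ * X](_ : _ = 0) ?mulr0; last by rewrite /ip !mul0r addr0.
move=> /eqP; rewrite mulf_eq0 gt_eqF ?expR_gt0//= => /eqP; exact: ip_eq0.
Qed.

End ComplexCalculus.

(** * Extremals on one edge *)

Section EdgeODE.
Variable R : realType.
Local Notation Re := complex.Re.
Local Notation Im := complex.Im.
Implicit Types u v : R -> R[i].

Definition is_cderive (t : R) u (l : R[i]) :=
  is_derive t (1 : R) (fun s => Re (u s)) (Re l) /\
  is_derive t (1 : R) (fun s => Im (u s)) (Im l).

Lemma is_cderive_eq t u l l' : l = l' -> is_cderive t u l -> is_cderive t u l'.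
Proof. by move=> ->. Qed.

Lemma is_cderiveM t u v l m : is_cderive t u l -> is_cderive t v m ->
  is_cderive t (fun s => u s * v s) (l * v t + u t * m).
Proof.
move=> [ur ui] [vr vi]; split.
  have := is_deriveB (is_deriveM ur vr) (is_deriveM ui vi).
  congr (is_derive _ _ _ _); first by apply/funext => s; rewrite ReM.
  by rewrite !ReImE /GRing.scale /=; ring.
have := is_deriveD (is_deriveM ur vi) (is_deriveM ui vr).
congr (is_derive _ _ _ _); first by apply/funext => s; rewrite ImM.
by rewrite !ReImE /GRing.scale /=; ring.
Qed.

Lemma is_cderiveD t u v l m : is_cderive t u l -> is_cderive t v m ->
  is_cderive t (fun s => u s + v s) (l + m).
Proof.
move=> [ur ui] [vr vi]; split; rewrite !ReImE.
  by have := is_deriveD ur vr; congr (is_derive _ _ _ _); apply/funext => s; rewrite ReD.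
by have := is_deriveD ui vi; congr (is_derive _ _ _ _); apply/funext => s; rewrite ImD.
Qed.

Lemma is_cderive_cst t c : is_cderive t (fun=> c) 0.
Proof. by split; exact: is_derive_cst. Qed.

Lemma is_cderive_real t (f : R -> R) l : is_derive t (1 : R) f l ->
  is_cderive t (fun s => (f s)%:C) l%:C.
Proof. by split => //=; exact: is_derive_cst. Qed.

Lemma is_cderiveZ t u l c : is_cderive t u l -> is_cderive t (fun s => c * u s) (c * l).
Proof.
move=> du; apply: is_cderive_eq (is_cderiveM (is_cderive_cst t c) du).
by rewrite mul0r add0r.
Qed.

Lemma is_derive_lin (c t : R) : is_derive t (1 : R) (fun s => c * s) c.
Proof.
have := @is_deriveZ R R R id c t 1 1 (is_derive_id _ _).
by rewrite [c *: 1]mulr1.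
Qed.

(** The complex exponential of [b t], in real terms so that it can be differentiated
    componentwise. *)
Definition cexp (b : R[i]) (t : R) : R[i] :=
  (expR (Re b * t))%:C * (cos (Im b * t) +i* sin (Im b * t)).

Lemma is_cderive_cexp b t : is_cderive t (cexp b) (b * cexp b t).
Proof.
have de := is_derive1_comp (is_derive_expR (Re b * t)) (is_derive_lin (Re b) t).
have dc := is_derive1_comp (is_derive_cos (Im b * t)) (is_derive_lin (Im b) t).
have ds := is_derive1_comp (is_derive_sin (Im b * t)) (is_derive_lin (Im b) t).
have [s' s'E] : exists s', s' = - sin (Im b * t) * Im b by eexists.
have [c' c'E] : exists c', c' = cos (Im b * t) * Im b by eexists.
rewrite -s'E in dc; rewrite -c'E in ds.
have dcs : is_cderive t (fun s => cos (Im b * s) +i* sin (Im b * s)) (s' +i* c') by split.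
apply: is_cderive_eq (is_cderiveM (is_cderive_real de) dcs).
rewrite /cexp; apply: complex_eq; rewrite !ReImE [Re (Complex _ _)]/= [Im (Complex _ _)]/=.
  by rewrite s'E /=; ring.
by rewrite c'E /=; ring.
Qed.

Lemma cexp0 b : cexp b 0 = 1.
Proof. by rewrite /cexp !mulr0 expR0 cos0 sin0 mul1r. Qed.

Lemma cexpK b t : cexp (- b) t * cexp b t = 1.
Proof.
have e1 : expR (- Re b * t) * expR (Re b * t) = 1.
  by rewrite -expRD mulNr addNr expR0.
have cs := cos2Dsin2 (Im b * t).
apply: complex_eq; rewrite /cexp !ReImE /= !mulNr cosN sinN in e1 *.
  transitivity ((expR (- (Re b * t)) * expR (Re b * t)) *
     (cos (Im b * t) ^+ 2 + sin (Im b * t) ^+ 2)); first by ring.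
  by rewrite e1 cs mulr1.
by ring.
Qed.

(** Holds because [2 Re b - b] is the conjugate of [b]. It links the two first-order equations of an
    extremal. *)
Lemma cexp_conj b t : cexp (- b) t * (expR (2 * Re b * t))%:C = cexp (conjc b) t.
Proof.
have e1 : expR (- Re b * t) * expR (2 * Re b * t) = expR (Re b * t).
  by rewrite -expRD; congr expR; ring.
apply: complex_eq; rewrite /cexp !ReImE /= -e1; ring.
Qed.

(** The closed form with [a^-1] breaks down at [a = 0], where the identity replaces it. Positivity
    at 1 allows a prescribed end value to be solved for. *)
Lemma exp_primitive (a : R) : exists phi : R -> R,
  [/\ forall t, is_derive t (1 : R) phi (expR (a * t)), phi 0 = 0 & 0 < phi 1].
Proof.
have [->|a0] := eqVneq a 0.
  exists id; split => // t; rewrite mul0r expR0; exact: is_derive_id.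
exists (fun t => a^-1 * (expR (a * t) + -1)); split => [t||].
- have de := is_derive1_comp (is_derive_expR (a * t)) (is_derive_lin a t).
  have := is_deriveZ a^-1 (is_deriveD de (@is_derive_cst R R R (-1) t 1)).
  by congr (is_derive _ _ _ _); rewrite addr0 /GRing.scale /= mulrCA mulVf// mulr1.
- by rewrite mulr0 expR0 subrr mulr0.
- rewrite mulr1; move: a0; rewrite neq_lt => /orP[an|ap].
    by rewrite nmulr_rgt0 ?invr_lt0// subr_lt0 expR_lt1.
  by rewrite mulr_gt0 ?invr_gt0// subr_gt0 expR_gt1.
Qed.

Lemma is_cderive_ac u v v' : (forall t, is_cderive t u (v t)) ->
  (forall t, is_cderive t v (v' t)) -> abs_cont01 u.
Proof.
move=> du dv; have cont (f f' : R -> R) : (forall t, is_derive t (1 : R) f (f' t)) ->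
    continuous f.
  by move=> df t; apply/differentiable_continuous/derivable1_diffP; have [] := df t.
apply/abs_cont01E; split.
  apply: (@real_ac_smooth _ _ (fun t => Re (v t))).
    by move=> t; have [] := du t.
  by apply: (cont _ (fun t => Re (v' t))) => t; have [] := dv t.
apply: (@real_ac_smooth _ _ (fun t => Im (v t))).
  by move=> t; have [] := du t.
by apply: (cont _ (fun t => Im (v' t))) => t; have [] := dv t.
Qed.

Lemma deriv01_cderive u t l : 0 <= t <= 1 -> is_cderive t u l -> deriv01 u t = l.
Proof.
move=> /unit_itvP Dt [ur ui]; apply: complex_eq => /=; exact: deriv01_realE.
Qed.

(* Solve [q' = conj b q] first, then [w' + b w = q]. *)
Lemma edge_extremal (b z0 z1 : R[i]) : exists w q : R -> R[i],
  [/\ w 0 = z0, w 1 = z1, abs_cont01 w, abs_cont01 q &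
      forall t, 0 <= t <= 1 -> deriv01 w t = q t - b * w t /\
                               deriv01 q t = conjc b * q t].
Proof.
have [phi [dphi phi0 phi1]] := exp_primitive (2 * Re b).
(* Variation of constants: with [phi' = expR (2 * Re b * t)] the function [w] satisfies
   [w' + b w = q]. It starts at [z0] because [phi 0 = 0], and [C] is the value that gives
   [w 1 = z1]. *)
pose C := (z1 * cexp b 1 - z0) / (phi 1)%:C.
pose w t := cexp (- b) t * (z0 + C * (phi t)%:C).
pose q t := C * cexp (conjc b) t.
have dq t : is_cderive t q (conjc b * q t).
  apply: is_cderive_eq (is_cderiveZ C (is_cderive_cexp (conjc b) t)).
  by rewrite /q mulrCA.
have dw t : is_cderive t w (q t - b * w t).
  have d1 := is_cderive_cexp (- b) t.
  have d2 := is_cderiveD (is_cderive_cst t z0) (is_cderiveZ C (is_cderive_real (dphi t))).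
  apply: is_cderive_eq (is_cderiveM d1 d2).
  by rewrite /w /q -cexp_conj; ring.
have phiC : (phi 1)%:C != 0 :> R[i].
  by apply/eqP => -[] /eqP; rewrite gt_eqF.
exists w, q; split.
- by rewrite /w cexp0 phi0 mulr0 addr0 mul1r.
- rewrite /w /C divfK// addrC subrK mulrCA.
  by rewrite cexpK mulr1.
- have dv t := is_cderiveD (dq t) (is_cderiveZ (- b) (dw t)).
  apply: is_cderive_ac dv => t; apply: is_cderive_eq (dw t).
  by rewrite mulNr.
- exact: is_cderive_ac dq (fun t => is_cderiveZ (conjc b) (dq t)).
- by move=> t t01; split; exact: deriv01_cderive.
Qed.

End EdgeODE.

(** * Sums over the edges *)

Section PositiveIndexSums.
Variable R : realType.
Implicit Types (a c z : nat -> R).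

(** Signed series are treated as real limits, nonnegative ones as the extended sums [esum1];
    [esum1P] passes between the two. Both start at 1, since index 0 is no edge and carries arbitrary
    values. *)
Definition has_sum1 a (s : R) := (fun n => \sum_(1 <= j < n) a j) @ \oo --> s.
Definition esum1 a : \bar R := (\sum_(1 <= j <oo) (a j)%:E)%E.

Definition summable1 a : bool := (esum1 a < +oo)%E.

Lemma eq_esum1 a c : (forall j, (0 < j)%N -> a j = c j) -> esum1 a = esum1 c.
Proof.
move=> ac; rewrite /esum1.
have E : (fun n => (\sum_(1 <= j < n) (a j)%:E)%E) =
    (fun n => (\sum_(1 <= j < n) (c j)%:E)%E).
  by apply/funext => n; apply: eq_big_nat => j /andP[j0 _]; rewrite ac.
by rewrite E.
Qed.

Lemma has_sum1_eq a c s : (forall j, (0 < j)%N -> a j = c j) ->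
  has_sum1 a s -> has_sum1 c s.
Proof.
move=> ac; rewrite /has_sum1 (_ : (fun n => _) = (fun n => \sum_(1 <= j < n) c j))//.
by apply/funext => n; apply: eq_big_nat => j /andP[j0 _]; rewrite ac.
Qed.

Lemma has_sum1_unique a s s' : has_sum1 a s -> has_sum1 a s' -> s = s'.
Proof. by move=> h h'; exact: (cvg_unique _ h h'). Qed.

Lemma has_sum1D a c s s' : has_sum1 a s -> has_sum1 c s' ->
  has_sum1 (fun j => a j + c j) (s + s').
Proof.
move=> ha hc; rewrite /has_sum1.
rewrite (_ : (fun n => _) = (fun n => \sum_(1 <= j < n) a j + \sum_(1 <= j < n) c j)).
  exact: cvgD.
by apply/funext => n; rewrite big_split.
Qed.

Lemma has_sum1Z k a s : has_sum1 a s -> has_sum1 (fun j => k * a j) (k * s).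
Proof.
move=> ha; rewrite /has_sum1.
rewrite (_ : (fun n => _) = (fun n => k * \sum_(1 <= j < n) a j)).
  by apply: cvgM => //; exact: cvg_cst.
by apply/funext => n; rewrite mulr_sumr.
Qed.

Lemma has_sum1B a c s s' : has_sum1 a s -> has_sum1 c s' ->
  has_sum1 (fun j => a j - c j) (s - s').
Proof.
move=> ha hc; have := has_sum1D ha (has_sum1Z (k := -1) hc); rewrite mulN1r.
by apply: has_sum1_eq => j _; rewrite mulN1r.
Qed.

Lemma has_sum1_supp a i : (0 < i)%N ->
  (forall j, (0 < j)%N -> j != i -> a j = 0) -> has_sum1 a (a i).
Proof.
move=> i0 az; rewrite /has_sum1; apply: cvg_near_cst; near=> n.
have ni : (i < n)%N by near: n; exact: nbhs_infty_gt.
rewrite (bigD1_seq i)/= ?iota_uniq ?mem_index_iota ?i0//.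
rewrite big_seq_cond big1 ?addr0// => j /andP[].
by rewrite mem_index_iota => /andP[j0 _] ji; exact: az.
Unshelve. all: by end_near. Qed.

Lemma esum1P a : (forall j, (0 < j)%N -> 0 <= a j) -> summable1 a ->
  exists2 s, has_sum1 a s & esum1 a = s%:E.
Proof.
move=> a0 fin.
have a0' : (0 <= esum1 a)%E.
  by apply: nneseries_ge0 => n n1 _; rewrite lee_fin a0.
have := is_cvg_nneseries (fun n (n1 : (1 <= n)%N) (_ : xpredT n) =>
  (a0 n n1 : (0 <= (a n)%:E)%E)).
rewrite -/(esum1 a) => cv.
exists (fine (esum1 a)); last by rewrite fineK// ge0_fin_numE.
have : (fun n => (\sum_(1 <= j < n) (a j)%:E)%E) @ \oo --> (fine (esum1 a))%:E.
  by rewrite fineK ?ge0_fin_numE//; exact: cv.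
move=> /fine_cvgP[_]; apply: cvg_trans.
by apply: near_eq_cvg; apply: nearW => n /=; rewrite sumEFin.
Qed.

Lemma has_sum1_esum1 a s : has_sum1 a s -> esum1 a = s%:E.
Proof.
move=> ha; apply/cvg_lim => //.
rewrite (_ : (fun n => _) = EFin \o (fun n => \sum_(1 <= j < n) a j)).
  by apply: cvg_EFin; [exact: nearW|exact: ha].
by apply/funext => n /=; rewrite sumEFin.
Qed.

Lemma esum1_ge0 a : (forall j, (0 < j)%N -> 0 <= a j) -> (0 <= esum1 a)%E.
Proof. by move=> a0; apply: nneseries_ge0 => n n1 _; rewrite lee_fin a0. Qed.

Lemma esum1_le a c : (forall j, (0 < j)%N -> 0 <= a j) ->
  (forall j, (0 < j)%N -> a j <= c j) -> (esum1 a <= esum1 c)%E.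
Proof.
move=> a0 ac; pose a' j := if j is 0%N then 0 else a j.
pose c' j := if j is 0%N then 0 else c j.
rewrite (@eq_esum1 a a'); last by case.
rewrite (@eq_esum1 c c'); last by case.
apply: lee_nneseries => [[|i] i1 _//|[|i] _//]; rewrite lee_fin.
- exact: a0.
- exact: ac.
Qed.

(** The series of [a] is the difference of the nonnegative convergent series of [a + c] and [c]. *)
Lemma has_sum1_dom a c : (forall j, (0 < j)%N -> `|a j| <= c j) ->
  summable1 c -> exists s, has_sum1 a s.
Proof.
move=> ac cfin.
have c0 j : (0 < j)%N -> 0 <= c j by move=> j0; exact: le_trans (ac _ j0).
have [sc hc _] := esum1P c0 cfin.
have ac0 j : (0 < j)%N -> 0 <= a j + c j.
  by move=> j0; have := ac _ j0; rewrite ler_norml => /andP[h _]; lra.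
have acfin : summable1 (fun j => a j + c j).
  apply: (@le_lt_trans _ _ (esum1 (fun j => 2 * c j))).
    apply: esum1_le => // j j0.
    by have := ac _ j0; rewrite ler_norml => /andP[_ h]; lra.
  by rewrite (has_sum1_esum1 (has_sum1Z (k := 2) hc)) ltry.
have [s hs _] := esum1P ac0 acfin.
exists (s - sc); apply: has_sum1_eq (has_sum1B hs hc) => j _.
by rewrite addrK.
Qed.

Lemma esum1_fin_le a c : (forall j, (0 < j)%N -> 0 <= a j) ->
  (forall j, (0 < j)%N -> a j <= c j) -> summable1 c -> summable1 a.
Proof. by move=> a0 ac; apply: le_lt_trans; exact: esum1_le. Qed.

Lemma esum1_finD a c : (forall j, (0 < j)%N -> 0 <= a j) ->
  (forall j, (0 < j)%N -> 0 <= c j) -> summable1 a -> summable1 c ->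
  summable1 (fun j => a j + c j).
Proof.
move=> a0 c0 /(esum1P a0)[s hs _] /(esum1P c0)[s' hs' _].
by rewrite /summable1 (has_sum1_esum1 (has_sum1D hs hs')) ltry.
Qed.

Lemma esum1_finZ k a : (forall j, (0 < j)%N -> 0 <= a j) -> summable1 a ->
  summable1 (fun j => k * a j).
Proof.
by move=> a0 /(esum1P a0)[s hs _]; rewrite /summable1 (has_sum1_esum1 (has_sum1Z (k := k) hs)) ltry.
Qed.

Lemma esum1E a : a 0%N = 0 -> (forall j, 0 <= a j) ->
  esum1 a = (\esum_(j in [set: nat]) (a j)%:E)%E.
Proof.
move=> a00 a0; rewrite -nneseries_esumT; last by move=> n; rewrite lee_fin.
rewrite [RHS]nneseries_recl//; last by move=> n _; rewrite lee_fin.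
by rewrite a00 add0e.
Qed.

Section Regroup.
Variables (P : pred nat) (nu : nat -> nat -> nat).
Hypothesis P0 : ~~ P 0%N.
Hypothesis nu_bij : set_bij [set il : nat * nat | P il.1]
  [set j | (1 < j)%N] (fun il => nu il.1 il.2).

(** Tonelli for sums: every index above 1 is [nu i l] for exactly one pair with [P i]. Index 1, the
    root edge, belongs to no group, whence the condition on [z 1]. *)
Lemma regroup_ge0 z : (forall j, 0 <= z j) -> z 0%N = 0 -> z 1%N = 0 ->
  esum1 z = (\sum_(1 <= i <oo)
    if P i then \sum_(0 <= l <oo) (z (nu i l))%:E else 0)%E.
Proof.
move=> z0 z00 z1; rewrite esum1E//.
transitivity (\esum_(j in [set j | (1 < j)%N]) (z j)%:E)%E.
  rewrite [RHS]esum_mkcond; apply: eq_esum => j _.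
  case: ifPn => //; rewrite notin_setE /=.
  by case: j => [|[|j]]; rewrite ?z00 ?z1//= => /negP.
rewrite (reindex_esum _ _ _ _ nu_bij).
pose F i : \bar R := (if P i then \sum_(0 <= l <oo) (z (nu i l))%:E else 0)%E.
have F0 i : (0 <= F i)%E.
  rewrite /F; case: ifPn => // _; apply: nneseries_ge0 => n _ _.
  by rewrite lee_fin.
rewrite -[RHS]/(\sum_(1 <= i <oo) F i)%E.
have -> : (\sum_(1 <= i <oo) F i = \sum_(0 <= i <oo) F i)%E.
  by rewrite [RHS]nneseries_recl// {2}/F (negbTE P0) add0e.
rewrite nneseries_esumT//.
transitivity (\esum_(i in [set i | P i]) (\esum_(l in [set: nat]) (z (nu i l))%:E))%E.
  rewrite (esum_esum (J := fun=> setT)); last by move=> i j _ _; rewrite lee_fin.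
  congr esum; apply/seteqP; split => -[i l] /=; by [split|case].
rewrite esum_mkcond; apply: eq_esum => i _; rewrite /F.
have -> : (i \in [set i | P i]) = P i by apply/idP/idP; rewrite inE.
by case: ifPn => // _; rewrite nneseries_esumT// => l; rewrite lee_fin.
Qed.

(** A finite total dominates every partial sum of the nonnegative group sums, hence each of them, so
    all groups have real sums. *)
Lemma regroup_ge0_sum z : (forall j, 0 <= z j) -> z 0%N = 0 -> z 1%N = 0 ->
  summable1 z -> exists S : nat -> R,
  (forall i, P i -> series (fun l => z (nu i l)) @ \oo --> S i) /\
  exists2 s, has_sum1 z s & has_sum1 (fun i => if P i then S i else 0) s.
Proof.
move=> z0 z00 z1 fin; have [s hs sE] := esum1P (fun j _ => z0 j) fin.
pose F i : \bar R := (if P i then \sum_(0 <= l <oo) (z (nu i l))%:E else 0)%E.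
have F0 i : (0 <= F i)%E.
  rewrite /F; case: ifPn => // _; apply: nneseries_ge0 => n _ _.
  by rewrite lee_fin.
have FE : (\sum_(1 <= i <oo) F i = s%:E)%E by rewrite -sE regroup_ge0.
have Ffin i : F i \is a fin_num.
  rewrite ge0_fin_numE// ltNge; apply/negP => Foo.
  have [i1|] := posnP i; first by move: Foo; rewrite /F i1 (negbTE P0).
  move=> i1; have := nneseries_lim_ge (P := xpredT) (m := 1) i.+1 (fun n _ _ => F0 n).
  rewrite FE (big_nat_recr i)//= => H.
  have : (F i <= s%:E)%E by apply: le_trans H; rewrite leeDr// sume_ge0.
  by move/(le_trans Foo); rewrite leye_eq.
exists (fun i => fine (F i)); split.
  move=> i Pi; have zi0 l : (0 <= (z (nu i l))%:E)%E by rewrite lee_fin.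
  have : (fun n => (\sum_(0 <= l < n) (z (nu i l))%:E)%E) @ \oo --> (fine (F i))%:E.
    rewrite fineK// /F Pi; apply: is_cvg_nneseries => n _ _; exact: zi0.
  move=> /fine_cvgP[_]; apply: cvg_trans.
  by apply: near_eq_cvg; apply: nearW => n /=; rewrite sumEFin.
exists s => //.
have : esum1 (fun i => fine (F i)) = s%:E.
  rewrite -FE /esum1; have E : (fun n => (\sum_(1 <= i < n) (fine (F i))%:E)%E) =
      (fun n => (\sum_(1 <= i < n) F i)%E).
    by apply/funext => n; apply: eq_bigr => i _; rewrite fineK.
  by rewrite E.
move=> FE'; have [||s' hs' s'E] := @esum1P (fun i => fine (F i)).
- by move=> j _; rewrite fine_ge0.
- by rewrite /summable1 FE' ltry.
- have -> : s = s' by move: s'E; rewrite FE' => -[].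
  by apply: has_sum1_eq hs' => i _; rewrite /F; case: ifP.
Qed.

Lemma regroup z : z 1%N = 0 -> summable1 (fun j => `|z j|) ->
  exists S : nat -> R,
  (forall i, P i -> series (fun l => z (nu i l)) @ \oo --> S i) /\
  exists2 s, has_sum1 z s & has_sum1 (fun i => if P i then S i else 0) s.
Proof.
move=> z1 fin.
(* Positive and negative parts, both reset to 0 at index 0, where [z] is unconstrained. *)
pose zp j := if j is 0%N then 0 else Num.max (z j) 0.
pose zm j := if j is 0%N then 0 else Num.max (- z j) 0.
have zp0 j : 0 <= zp j by case: j => [|j] //=; rewrite le_max lexx orbT.
have zm0 j : 0 <= zm j by case: j => [|j] //=; rewrite le_max lexx orbT.
have zE j : (0 < j)%N -> zp j - zm j = z j.
  case: j => // j _ /=; case: (leP (z j.+1) 0) => h.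
    by rewrite max_l ?oppr_ge0// sub0r opprK.
  by rewrite max_r ?oppr_le0 ?subr0// ltW.
have fp : summable1 zp.
  apply: esum1_fin_le fin => [j _|[|j] _]//=.
  by rewrite ge_max normr_ge0 ler_norm.
have fm : summable1 zm.
  apply: esum1_fin_le fin => [j _|[|j] _]//=.
  by rewrite ge_max normr_ge0 -normrN ler_norm.
have zp1 : zp 1%N = 0 by rewrite /= z1 maxxx.
have zm1 : zm 1%N = 0 by rewrite /= z1 oppr0 maxxx.
have [Sp [cp [sp hp hp']]] := regroup_ge0_sum zp0 erefl zp1 fp.
have [Sm [cm [sm hm hm']]] := regroup_ge0_sum zm0 erefl zm1 fm.
exists (fun i => Sp i - Sm i); split.
  move=> i Pi; have [nuP _ _] := nu_bij.
  have -> : series (fun l => z (nu i l)) =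
      series (fun l => zp (nu i l)) \- series (fun l => zm (nu i l)).
    apply/funext => n; rewrite /series /= -sumrB; apply: eq_bigr => l _.
    by rewrite zE// ltnW//; exact: (nuP (i, l) Pi).
  exact: cvgB (cp i Pi) (cm i Pi).
exists (sp - sm); first by apply: has_sum1_eq (has_sum1B hp hm).
apply: has_sum1_eq (has_sum1B hp' hm') => j _.
by case: ifP => //; rewrite subrr.
Qed.

End Regroup.

End PositiveIndexSums.

(** * The energy of a single edge *)

Section Edge.
Variable R : realType.
Implicit Types u v w q : R -> R[i].

(** [ell] freed from the tuple, so that the function on one edge can be exchanged; [ell b y j]
    unfolds to [edge_op (b j) (y j)]. *)
Definition edge_op (b : R[i]) u (t : R) : R[i] := deriv01 u t + b * u t.

Lemma sqint_ge0 u : 0 <= sqint u.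
Proof. by apply: int01_ge0 => t; exact: ip_ge0. Qed.

Lemma sqint_eq u v : in_L2 v -> ae01 (fun t => u t = v t) -> sqint u = sqint v.
Proof.
move=> /in_L2P[_ _ iv] uv; apply: int01_eq => //.
by apply: ae01_imp uv => t _ ->.
Qed.

Lemma sqintZ c u : in_L2 u -> sqint (fun t => c * u t) = ip c c * sqint u.
Proof.
move=> /in_L2P[_ _ iu]; rewrite /sqint -int01Z//.
by congr int01; apply/funext => t; rewrite ipM_sqr.
Qed.

Lemma sqintD u v : in_L2 u -> in_L2 v -> sqint (fun t => u t + v t) =
  sqint u + sqint v + 2 * int01 (fun t => ip (u t) (v t)).
Proof.
move=> uL vL; have /in_L2P[_ _ iu] := uL; have /in_L2P[_ _ iv] := vL.
have iuv := in_L2_ip uL vL.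
rewrite /sqint -int01Z// -!int01D//; first by congr int01; apply/funext => t; rewrite ip_sqrD.
  exact: ae_integrableD.
exact: ae_integrableZ.
Qed.

Lemma sqintD_le u v : in_L2 u -> in_L2 v ->
  sqint (fun t => u t + v t) <= 2 * sqint u + 2 * sqint v.
Proof.
move=> uL vL; have /in_L2P[_ _ iu] := uL; have /in_L2P[_ _ iv] := vL.
have /in_L2P[_ _ iuv] := in_L2D uL vL.
rewrite /sqint -!int01Z// -int01D; try exact: ae_integrableZ.
apply: int01_le => //; last by move=> t; exact: ipD_le.
by apply: ae_integrableD; exact: ae_integrableZ.
Qed.

Lemma sobolev1P u : sobolev 1 u <-> abs_cont01 u /\ in_L2 (deriv01 u).
Proof.
split=> [[ac L2]|[ac L2]]; first by split => //; exact: (ac 0%N).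
by split => // -[|].
Qed.

Lemma sobolev2P u : sobolev 2 u <->
  [/\ abs_cont01 u, abs_cont01 (deriv01 u) & in_L2 (deriv01 (deriv01 u))].
Proof.
split=> [[ac L2]|[ac ac1 L2]].
  by split => //; [exact: (ac 0%N)|exact: (ac 1%N)].
by split => // -[|[|]].
Qed.

Lemma sqnorm_sobolev1 u : sobolev 1 u ->
  sqnorm_sobolev 1 u = (sqint u + sqint (deriv01 u))%:E.
Proof.
move=> /sobolev1P[ac L2]; rewrite /sqnorm_sobolev !big_ord_recl big_ord0 /= adde0.
by rewrite !sqnorm_L2E//; exact: abs_cont01_L2.
Qed.

Lemma sqnorm_sobolev2 u : sobolev 2 u ->
  sqnorm_sobolev 2 u =
  (sqint u + sqint (deriv01 u) + sqint (deriv01 (deriv01 u)))%:E.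
Proof.
move=> /sobolev2P[ac ac1 L2].
have -> : sqnorm_sobolev 2 u =
    (sqnorm_L2 u + sqnorm_L2 (deriv01 u) + sqnorm_L2 (deriv01 (deriv01 u)))%E.
  rewrite /sqnorm_sobolev -(big_mkord xpredT (fun m => sqnorm_L2 (iter m (@deriv01 R) u))).
  by rewrite !big_nat_recr// big_geq// Monoid.mul1m.
rewrite (sqnorm_L2E (abs_cont01_L2 ac)) (sqnorm_L2E (abs_cont01_L2 ac1)).
by rewrite (sqnorm_L2E L2) !EFinD.
Qed.

Lemma sobolev1_comb c u v : sobolev 1 u -> sobolev 1 v ->
  sobolev 1 (fun t => u t + c * v t) /\
  ae01 (fun t => deriv01 (fun t => u t + c * v t) t = deriv01 u t + c * deriv01 v t).
Proof.
move=> /sobolev1P[acu uL] /sobolev1P[acv vL].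
have accv := abs_cont01Z c acv.
have dE : ae01 (fun t => deriv01 (fun t => u t + c * v t) t = deriv01 u t + c * deriv01 v t).
  by apply: ae01_imp2 (deriv01D acu accv) (deriv01Z c acv) => t _ -> ->.
split; last exact: dE.
apply/sobolev1P; split; first exact: abs_cont01D.
apply: (@in_L2_eq _ (fun t => deriv01 u t + c * deriv01 v t)).
  by apply: ae01_imp dE => t _ ->.
by apply: in_L2D => //; exact: in_L2Z.
Qed.

Lemma sobolev1_op b u : sobolev 1 u -> in_L2 (edge_op b u).
Proof.
by move=> /sobolev1P[ac L2]; apply: in_L2D => //; apply/in_L2Z/abs_cont01_L2.
Qed.

Lemma edge_op_comb b c u v : sobolev 1 u -> sobolev 1 v ->
  ae01 (fun t => edge_op b (fun t => u t + c * v t) t = edge_op b u t + c * edge_op b v t).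
Proof.
move=> su sv; have [_ dE] := sobolev1_comb c su sv.
by apply: ae01_imp dE => t _; rewrite /edge_op => ->; ring.
Qed.

Lemma edge_op_le b u : sobolev 1 u -> sqint (edge_op b u) <=
  (2 + 2 * ip b b) * (sqint u + sqint (deriv01 u)).
Proof.
move=> /sobolev1P[ac L2]; have uL := abs_cont01_L2 ac.
apply: le_trans (sqintD_le L2 (in_L2Z b uL)) _; rewrite sqintZ//.
have := sqint_ge0 u; have := sqint_ge0 (deriv01 u); have := ip_ge0 b; nra.
Qed.

(** A real [e] can be taken out of the real pairing, so the energy along a line is a quadratic
    polynomial in [e]. *)
Lemma edge_energy_comb b (e : R) u v : sobolev 1 u -> sobolev 1 v ->
  sqint (edge_op b (fun t => u t + e%:C * v t)) =
  sqint (edge_op b u) + e ^+ 2 * sqint (edge_op b v) +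
  2 * e * int01 (fun t => ip (edge_op b v t) (edge_op b u t)).
Proof.
move=> su sv; have uL := sobolev1_op b su; have vL := sobolev1_op b sv.
have evL := in_L2Z e%:C vL.
rewrite (sqint_eq (in_L2D uL evL) (edge_op_comb b e%:C su sv)) sqintD// sqintZ//.
have -> : ip e%:C e%:C = e ^+ 2 by rewrite /ip !ReImE mulr0 addr0.
congr (_ + _); rewrite -mulrA; congr (_ * _).
rewrite -int01Z; last exact: in_L2_ip.
by congr int01; apply/funext => t; rewrite /ip !ReImE; ring.
Qed.

(** Write [u = w + v] with [v] zero at both ends. Green's identity kills the cross term, so the
    energy of [u] exceeds that of [w] by the energy of [v]. If there is no excess, [v] solves
    [v' + b v = 0] with [v 0 = 0], hence vanishes. *)
Lemma edge_minimal b u w q : sobolev 1 u -> abs_cont01 w -> abs_cont01 q ->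
  w 0 = u 0 -> w 1 = u 1 ->
  (forall t, 0 <= t <= 1 -> deriv01 w t = q t - b * w t /\
                            deriv01 q t = conjc b * q t) ->
  sobolev 1 w /\ (sqint (edge_op b u) <= sqint (edge_op b w) ->
  forall t, 0 <= t <= 1 -> u t = w t).
Proof.
move=> su acw acq w0 w1 wq; have /sobolev1P[acu uL] := su.
have opw : ae01 (fun t => edge_op b w t = q t).
  apply: ae01_all => t /andP[t0 t1]; rewrite /edge_op.
  by have [|-> _] := wq t; rewrite ?subrK// !ltW.
have sw : sobolev 1 w.
  apply/sobolev1P; split; first exact: acw.
  apply: (@in_L2_eq _ (fun t => q t + (- b) * w t)).
    apply: ae01_all => t /andP[t0 t1].
    by have [|-> _] := wq t; rewrite ?mulNr// !ltW.
  by apply: in_L2D; [exact: abs_cont01_L2|apply/in_L2Z/abs_cont01_L2].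
split=> // le_uw t t01.
pose v t := u t + (-1) * w t.
have [sv _] := sobolev1_comb (-1) su sw; rewrite -/v in sv.
have /sobolev1P[acv vL] := sv.
have uE : u = (fun t => w t + 1%:C * v t).
  by apply/funext => s; rewrite /v mul1r mulN1r addrC subrK.
have := edge_energy_comb b 1 sw sv; rewrite -uE => E.
have cr0 : int01 (fun t => ip (edge_op b v t) (edge_op b w t)) = 0.
  rewrite (@int01_eq _ _ (fun t => ip (edge_op b v t) (q t))).
  - rewrite (green_edge (u := v) acv acq); last first.
      by apply: ae01_all => s /andP[s0 s1]; have [|_ ->] := wq s; rewrite // !ltW.
    by rewrite /v w0 w1 !mulN1r !subrr /ip !mul0r !addr0 subrr.
  - by apply: ae01_imp opw => s _ ->.
  - by apply: in_L2_ip; [exact: sobolev1_op|exact: abs_cont01_L2].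
have z0 : sqint (edge_op b v) = 0.
  apply/eqP; rewrite eq_le sqint_ge0 andbT.
  move: E; rewrite cr0 mulr0 addr0 expr1n mul1r => E.
  by rewrite -(lerD2l (sqint (edge_op b w))) addr0 -E.
have /in_L2P[_ _ iop] := sobolev1_op b sv.
have vz : ae01 (fun t => deriv01 v t + b * v t = 0).
  apply: ae01_imp (int01_eq0 iop _ z0); last by move=> s; exact: ip_ge0.
  by move=> s _ /ip_eq0.
have v0 : v 0 = 0 by rewrite /v w0 mulN1r subrr.
have := homogeneous_zero acv v0 vz t01.
by rewrite /v mulN1r => /eqP; rewrite subr_eq0 => /eqP.
Qed.

End Edge.

(** * The tree *)

Section Tree.
Variables (T : nat) (k d : nat -> nat) (nu : nat -> nat -> nat).
Hypothesis tree : tiered_tree T k d.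
Hypothesis nu_enum : forall j, internal T j ->
  set_bij [set: nat] (children k j) (nu j).

Lemma internal_gt0 j : internal T j -> (0 < j)%N.
Proof. by rewrite /internal /=; case: ifP => [_ /eqP ->//|_]; case: j. Qed.

Lemma internal0 : ~~ internal T 0%N.
Proof. by apply/negP => /internal_gt0. Qed.

Lemma leafE j : (0 < j)%N -> leaf T j = ~~ internal T j.
Proof. by rewrite /leaf /= => ->. Qed.

Lemma parent_root : k 1 = 0%N.
Proof.
by have /seteqP[_ /(_ 1%N erefl)[]] := tree_root tree.
Qed.

Lemma parent_internal j : (1 < j)%N -> internal T (k j).
Proof.
move=> j1; have j0 : (0 < j)%N by rewrite ltnW.
have [kj|//] := tree_into tree j0.
have /seteqP[/(_ j) H _] := tree_root tree.
by have := H (conj j0 kj); move=> /= jE; rewrite jE in j1.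
Qed.

Lemma nu_child i l : internal T i -> (1 < nu i l)%N /\ k (nu i l) = i.
Proof.
move=> ii; have [/(_ l I)[n0 ki] _ _] := nu_enum ii.
split=> //; move: n0; rewrite leq_eqVlt => /orP[/eqP n1|//].
by move: ii; rewrite -ki -n1 parent_root (negbTE internal0).
Qed.

Lemma nu_surj j : (1 < j)%N -> exists l, nu (k j) l = j.
Proof.
move=> j1; have [_ _ H] := nu_enum (parent_internal j1).
have [|l _ E] := H j; first by split => //; rewrite ltnW.
by exists l.
Qed.

(** Every edge except the root edge leaves exactly one internal vertex and occurs once in its
    enumeration; this is the bijection behind the regrouping of sums. *)
Lemma nu_bij : set_bij [set il : nat * nat | internal T il.1]
  [set j | (1 < j)%N] (fun il => nu il.1 il.2).
Proof.
split.
- by move=> [i l] /= ii; have [] := nu_child l ii.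
- move=> [i l] [i' l']; rewrite !inE /= => ii ii' E.
  have [_ ki] := nu_child l ii; have [_ ki'] := nu_child l' ii'.
  have Ei : i = i' by rewrite -ki -ki' E.
  subst i'; have [_ inj _] := nu_enum ii.
  by rewrite (inj l l')// inE.
- move=> j /= j1; have [l E] := nu_surj j1.
  by exists (k j, l) => //=; exact: parent_internal.
Qed.

Lemma parent_neq j : (1 < j)%N -> k j != j.
Proof.
move=> j1; apply/eqP => kj.
have := tree_depth tree (ltnW j1).
have -> : iter (d j) k j = j by elim: (d j) => //= n ->.
by move=> jE; rewrite jE in j1.
Qed.

(** Before step [d j] the value 1 is excluded by the first hitting time, and 0 because the parent of
    an index above 1 is internal. *)
Lemma ancestor_gt1 j m : (0 < j)%N -> (m < d j)%N -> (1 < iter m k j)%N.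
Proof.
move=> j0; elim: m => [|m IH] md.
  have := tree_depth_first tree j0 md => /= /eqP.
  by rewrite ltn_neqAle eq_sym => ->.
have := tree_depth_first tree j0 md => /= /eqP n1.
by rewrite ltn_neqAle eq_sym n1 /=; apply/internal_gt0/parent_internal/IH/ltnW.
Qed.

(** After one step the ancestors of the child are those of [i], and both depths are first hitting
    times of 1, so neither can be smaller than predicted. *)
Lemma depth_child i l : internal T i -> d (nu i l) = (d i).+1.
Proof.
move=> ii; have [n1 ki] := nu_child l ii.
have n0 := ltnW n1; have i0 := internal_gt0 ii.
apply/eqP; rewrite eqn_leq; apply/andP; split; rewrite leqNgt; apply/negP => lt.
  have := tree_depth_first tree n0 lt; apply.
  by rewrite iterSr ki; exact: (tree_depth tree i0).
have := tree_depth tree n0.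
case E : (d (nu i l)) lt => [|m] lt; first by move=> /= nE; rewrite nE in n1.
by rewrite iterSr ki; apply: (tree_depth_first tree).
Qed.

Variables (R : realType) (p : nat -> R) (pt : nat -> R).
Hypothesis p_gt0 : forall l, 0 < p l.
Hypothesis pt_child : forall j l, internal T j -> pt (nu j l) = p l.
Local Notation alpha := (edge_weight k d pt).

Lemma alpha_child i l : internal T i -> alpha (nu i l) = p l * alpha i.
Proof.
move=> ii; have [_ ki] := nu_child l ii.
rewrite /edge_weight depth_child// big_ord_recl /= pt_child//.
by congr (_ * _); apply: eq_bigr => m _; rewrite /= add0n -iterS iterSr ki.
Qed.

(** Every factor belongs to an ancestor above 1, which is a child of an internal vertex and so
    carries some [p l]. *)
Lemma alpha_gt0 j : (0 < j)%N -> 0 < alpha j.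
Proof.
move=> j0; apply: prodr_gt0 => m _.
have m1 := ancestor_gt1 j0 (ltn_ord m).
have [l <-] := nu_surj m1.
by rewrite pt_child//; exact: parent_internal.
Qed.

End Tree.

(** * Complex limits and series through real and imaginary parts *)

Section ComplexLimits.
Variable R : realType.
Local Notation Re := complex.Re.
Local Notation Im := complex.Im.

Lemma normE (z : R[i]) : `|z| = (normc z)%:C.
Proof. by case: z. Qed.

Lemma cvg_complexP (u : nat -> R[i]^o) (l : R[i]^o) : u @ \oo --> l <->
  (fun n => Re (u n)) @ \oo --> Re l /\ (fun n => Im (u n)) @ \oo --> Im l.
Proof.
split=> [ul|[ur ui]].
  have H (e : R) : 0 < e -> \forall n \near \oo, normc (l - u n) < e.
    move=> e0; have e0' : 0 < e%:C :> R[i] by rewrite ltcR.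
    move/cvgrPdist_lt : ul => /(_ _ e0'); apply: filterS => n.
    by rewrite normE ltcR.
  split; apply/cvgrPdist_lt => e /H; apply: filterS => n; apply: le_lt_trans.
    by rewrite -ReN -ReD; case: (l - u n) => a c /=; rewrite -[leLHS]sqrtr_sqr ler_wsqrtr// lerDl sqr_ge0.
  by rewrite -ImN -ImD; case: (l - u n) => a c /=; rewrite -[leLHS]sqrtr_sqr ler_wsqrtr// lerDr sqr_ge0.
apply/cvgrPdist_lt => e e0.
(* In the order of [R[i]] a positive number is real, so the complex tolerance is its own real
   part. *)
have eE : e = (Re e)%:C by apply: complex_eq => //=; move: e0; rewrite ltcE => /andP[/eqP].
have re0 : 0 < Re e by rewrite -ltcR -eE.
have e2 : 0 < Re e / 2 by rewrite divr_gt0.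
move/cvgrPdist_lt : ur => /(_ _ e2) hr; move/cvgrPdist_lt : ui => /(_ _ e2) hi.
apply: filterS2 hr hi => n hr hi; rewrite normE eE ltcR.
apply: le_lt_trans (_ : _ <= `|Re l - Re (u n)| + `|Im l - Im (u n)|) _; last first.
  by rewrite [X in _ < X]splitr ltrD.
rewrite -ReN -ReD -ImN -ImD.
rewrite -[leRHS]ger0_norm ?addr_ge0// -[leRHS]sqrtr_sqr; case: (l - u n) => a c /=.
rewrite ler_wsqrtr// sqrrD !real_normK ?num_real// addrAC lerDl.
by rewrite mulrn_wge0// mulr_ge0.
Qed.

Lemma cvg_series_complexP (f : nat -> R[i]^o) (l : R[i]^o) :
  series f @ \oo --> l <->
  series (fun n => Re (f n)) @ \oo --> Re l /\ series (fun n => Im (f n)) @ \oo --> Im l.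
Proof.
have rE : series (fun n => Re (f n)) = (fun n => Re (series f n)).
  apply/funext => n; rewrite /series /=.
  elim: n => [|n IH]; first by rewrite !big_geq.
  by rewrite !big_nat_recr//= ReD IH.
have iE : series (fun n => Im (f n)) = (fun n => Im (series f n)).
  apply/funext => n; rewrite /series /=.
  elim: n => [|n IH]; first by rewrite !big_geq.
  by rewrite !big_nat_recr//= ImD IH.
rewrite rE iE; exact: cvg_complexP.
Qed.

Lemma cvg_series_dom (p f : nat -> R) (M : R) : (forall l, 0 < p l) ->
  cvgn (series p) -> (forall l, `|f l| <= M) -> cvgn (series (fun l => p l * f l)).
Proof.
move=> p0 cp fM; apply: normed_cvg.
have cM : cvgn (series (fun l => M * p l)).
  exact: (is_cvg_seriesZ (k := M) cp).
apply: series_le_cvg cM.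
- by move=> n; exact: normr_ge0.
- move=> n; apply: mulr_ge0; last exact: ltW.
  exact: le_trans (normr_ge0 (f 0%N)) (fM 0%N).
- move=> n /=; rewrite normrM (gtr0_norm (p0 n)) mulrC.
  by apply: ler_wpM2r; [exact: ltW|exact: fM].
Qed.

End ComplexLimits.

(** Combines the trace bounds for [h] (through [v]) and for [q] (through [w]) after [ip_le];
    [dq <= B * E] comes from the equation for [q]. *)
Lemma edge_bound_arith (R : realType) (v w s ds E dq B : R) : v <= 2 * s + ds ->
  w <= 2 * E + dq -> dq <= B * E -> 0 <= ds -> 0 <= B * E ->
  (v + w) / 2 <= s + ds + (1 + B) * E.
Proof. by rewrite (mulrDl 1 B E) mul1r; move: (B * E) => BE; lra. Qed.

Lemma comb_bound_arith (R : realType) (s ds t dt e : R) :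
  2 * s + 2 * (e * t) + (2 * ds + 2 * (e * dt)) = 2 * (s + ds) + 2 * e * (t + dt).
Proof. by ring. Qed.

(** * The energy on the whole tree and Green's identity *)

Section Energy.
Variables (R : realType) (T : nat) (k d : nat -> nat) (nu : nat -> nat -> nat).
Variables (p : nat -> R) (b : nat -> R[i]) (pt : nat -> R).
Hypothesis tree : tiered_tree T k d.
Hypothesis nu_enum : forall j, internal T j ->
  set_bij [set: nat] (children k j) (nu j).
Hypothesis p_gt0 : forall l, 0 < p l.
Hypothesis pt_child : forall j l, internal T j -> pt (nu j l) = p l.
Variable B : R.
Hypothesis b_le : forall j, (0 < j)%N -> ip (b j) (b j) <= B.
Local Notation alpha := (edge_weight k d pt).
Implicit Types y z h : nat -> R -> R[i].

Let a_gt0 j : (0 < j)%N -> 0 < alpha j.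
Proof. exact: (alpha_gt0 tree nu_enum p_gt0 pt_child). Qed.

Let B_ge0 : 0 <= B.
Proof. by apply: le_trans (b_le (j := 1) _); rewrite ?ip_ge0. Qed.

Lemma eq_eseries1 (f g : nat -> \bar R) : (forall j, (0 < j)%N -> f j = g j) ->
  (\sum_(1 <= j <oo) f j = \sum_(1 <= j <oo) g j)%E.
Proof.
move=> fg; have E : (fun n => (\sum_(1 <= j < n) f j)%E) =
    (fun n => (\sum_(1 <= j < n) g j)%E).
  by apply/funext => n; apply: eq_big_nat => j /andP[j0 _]; rewrite fg.
by rewrite E.
Qed.

Definition sqnorm1 (u : R -> R[i]) : R := sqint u + sqint (deriv01 u).

Lemma sqnorm1_ge0 u : 0 <= sqnorm1 u.
Proof. by rewrite addr_ge0 ?sqint_ge0. Qed.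

Lemma weighted1P y : weighted_sobolev alpha 1 y <->
  (forall j, (0 < j)%N -> sobolev 1 (y j)) /\
  summable1 (fun j => alpha j * sqnorm1 (y j)).
Proof.
split=> -[sy fin]; split=> //; move: fin; rewrite /summable1 /esum1;
  congr (_ < _)%E; apply: eq_eseries1 => j j0; rewrite EFinM;
  by rewrite /sqnorm1 sqnorm_sobolev1//; exact: sy.
Qed.

Definition edge_energy y j : R := sqint (edge_op (b j) (y j)).

(** Uniformly bounded coefficients make each edge energy at most [2 + 2 * B] times the squared norm
    on that edge, so the functional is finite on the whole space and can be handled as a real
    series. *)
Lemma energy_sum y : weighted_sobolev alpha 1 y ->
  exists2 s, has_sum1 (fun j => alpha j * edge_energy y j) s & energy alpha b y = s%:E.
Proof.
move=> /weighted1P[sy fin].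
have a0 j : (0 < j)%N -> 0 <= alpha j * edge_energy y j.
  by move=> j0; rewrite mulr_ge0 ?sqint_ge0// ltW// a_gt0.
have n0 j : (0 < j)%N -> 0 <= alpha j * sqnorm1 (y j).
  by move=> j0; rewrite mulr_ge0 ?sqnorm1_ge0// ltW// a_gt0.
have fin' : summable1 (fun j => alpha j * edge_energy y j).
  apply: esum1_fin_le a0 _ (esum1_finZ (2 + 2 * B) n0 fin) => j j0.
  rewrite mulrCA ler_pM2l ?a_gt0//.
  apply: le_trans (edge_op_le (b j) (sy _ j0)) _.
  by rewrite ler_wpM2r ?sqnorm1_ge0// lerD2l ler_pM2l// b_le.
have [s hs sE] := esum1P a0 fin'; exists s => //; rewrite -sE.
apply: eq_eseries1 => j j0; rewrite EFinM; congr (_ * _)%E.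
exact: (sqnorm_L2E (sobolev1_op (b j) (sy _ j0))).
Qed.

Definition comb (e : R) y h : nat -> R -> R[i] := fun j t => y j t + e%:C * h j t.

Lemma sqnorm1_comb_le (e : R) u v : sobolev 1 u -> sobolev 1 v ->
  sqnorm1 (fun t => u t + e%:C * v t) <= 2 * sqnorm1 u + 2 * e ^+ 2 * sqnorm1 v.
Proof.
move=> su sv; have [_ dE] := sobolev1_comb e%:C su sv.
have /sobolev1P[acu uL] := su; have /sobolev1P[acv vL] := sv.
have uL0 := abs_cont01_L2 acu; have vL0 := abs_cont01_L2 acv.
have ee : ip e%:C e%:C = e ^+ 2 by rewrite /ip !ReImE mulr0 addr0.
rewrite /sqnorm1 (sqint_eq (in_L2D uL (in_L2Z e%:C vL)) dE).
have h1 := sqintD_le uL0 (in_L2Z e%:C vL0).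
have h2 := sqintD_le uL (in_L2Z e%:C vL).
rewrite (sqintZ e%:C vL0) ee in h1; rewrite (sqintZ e%:C vL) ee in h2.
have := lerD h1 h2; rewrite comb_bound_arith; exact: id.
Qed.

Lemma weighted1_comb (e : R) y h : weighted_sobolev alpha 1 y ->
  weighted_sobolev alpha 1 h -> weighted_sobolev alpha 1 (comb e y h).
Proof.
move=> /weighted1P[sy fy] /weighted1P[sh fh]; apply/weighted1P.
have n0 z j : (0 < j)%N -> 0 <= alpha j * sqnorm1 (z j).
  by move=> j0; rewrite mulr_ge0 ?sqnorm1_ge0// ltW// a_gt0.
split=> [j j0|].
  by have [] := sobolev1_comb e%:C (sy _ j0) (sh _ j0).
have f2 := esum1_finD (fun j j0 => mulr_ge0 (ler0n _ 2) (n0 y j j0))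
  (fun j j0 => mulr_ge0 (mulr_ge0 (ler0n _ 2) (sqr_ge0 e)) (n0 h j j0))
  (esum1_finZ 2 (n0 y) fy) (esum1_finZ (2 * e ^+ 2) (n0 h) fh).
apply: esum1_fin_le (n0 _) _ f2 => j j0.
have := sqnorm1_comb_le e (sy _ j0) (sh _ j0).
rewrite -(ler_pM2l (a_gt0 j0)) => /le_trans; apply.
rewrite mulrDr (mulrCA (alpha j) 2) (mulrCA (alpha j) (2 * e ^+ 2)); exact: lexx.
Qed.

Definition test_conditions h := [/\ h 1%N 0 = 0,
  forall j, (2 <= j)%N -> h (k j) 1 = h j 0 & forall j, leaf T j -> h j 1 = 0].

Lemma vertex_comb phi0 phi1 (e : R) y h : vertex_conditions T k phi0 phi1 y ->
  test_conditions h -> vertex_conditions T k phi0 phi1 (comb e y h).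
Proof.
move=> [y0 yc y1] [h0 hc h1]; split; rewrite /comb.
- by rewrite h0 mulr0 addr0.
- by move=> j j2; rewrite hc// yc.
- by move=> j lj; rewrite h1// mulr0 addr0 y1.
Qed.

(** The differential equation in first-order form, meaningful before a second derivative of [y j] is
    available. *)
Definition extremal y := forall j, (0 < j)%N -> abs_cont01 (ell b y j) /\
  ae01 (fun t => deriv01 (ell b y j) t = conjc (b j) * ell b y j t).

Definition cross y h j : R := int01 (fun t => ip (ell b h j t) (ell b y j t)).

Lemma energy_comb (e : R) y h ey eh s : weighted_sobolev alpha 1 y ->
  weighted_sobolev alpha 1 h ->
  has_sum1 (fun j => alpha j * edge_energy y j) ey ->
  has_sum1 (fun j => alpha j * edge_energy h j) eh ->
  has_sum1 (fun j => alpha j * cross y h j) s ->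
  energy alpha b (comb e y h) = (ey + e ^+ 2 * eh + 2 * e * s)%:E.
Proof.
move=> wy wh sey seh ss; have [s' hs' ->] := energy_sum (weighted1_comb e wy wh).
congr EFin; apply: (has_sum1_unique hs').
have /weighted1P[sy _] := wy; have /weighted1P[sh _] := wh.
apply: has_sum1_eq (has_sum1D (has_sum1D sey (has_sum1Z (k := e ^+ 2) seh))
  (has_sum1Z (k := 2 * e) ss)) => j j0.
rewrite /edge_energy /comb (edge_energy_comb (b j) e (sy _ j0) (sh _ j0)).
rewrite /cross; change (ell b h j) with (edge_op (b j) (h j)).
change (ell b y j) with (edge_op (b j) (y j)).
move: (sqint _) (sqint _) (int01 _) => A1 A2 A3; ring.
Qed.

(** The terms at the ends [t = 1] and [t = 0] are summed separately, and only the latter are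
    regrouped by parent: there [h (nu i l) 0 = h i 1] and the weight is [p l * alpha i]. At leaves
    [h] vanishes, so only internal vertices remain. *)
Lemma green_tree y h : weighted_sobolev alpha 1 y -> extremal y ->
  weighted_sobolev alpha 1 h -> test_conditions h ->
  exists (S : nat -> R) (s : R),
  [/\ forall i, internal T i ->
        series (fun l => alpha i * (p l * ip (h i 1) (ell b y (nu i l) 0))) @ \oo --> S i,
      has_sum1 (fun i => if internal T i
        then alpha i * ip (h i 1) (ell b y i 1) - S i else 0) s &
      has_sum1 (fun j => alpha j * cross y h j) s].
Proof.
move=> wy ey wh [h0 hc h1].
have /weighted1P[sy fy] := wy; have /weighted1P[sh fh] := wh.
have [sE hE _] := energy_sum wy.
pose q := ell b y.
pose X j := alpha j * ip (h j 1) (q j 1).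
pose Z j := alpha j * ip (h j 0) (q j 0).
have n0 z j : (0 < j)%N -> 0 <= alpha j * sqnorm1 (z j).
  by move=> j0; rewrite mulr_ge0 ?sqnorm1_ge0// ltW// a_gt0.
have e0 j : (0 < j)%N -> 0 <= alpha j * edge_energy y j.
  by move=> j0; rewrite mulr_ge0 ?sqint_ge0// ltW// a_gt0.
have fE : summable1 (fun j => alpha j * edge_energy y j).
  by rewrite /summable1 (has_sum1_esum1 hE) ltry.
have K0 : 0 <= 1 + B by rewrite addr_ge0.
have fC := esum1_finD (n0 h) (fun j j0 => mulr_ge0 K0 (e0 j j0)) fh
  (esum1_finZ (1 + B) e0 fE).
(* Absolute summability of both families of end terms. For [q] the derivative is [conjc (b j) * q],
   so the trace estimate costs only a multiple of the edge energy. *)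
have bound j : (0 < j)%N ->
    `|X j| <= alpha j * sqnorm1 (h j) + (1 + B) * (alpha j * edge_energy y j) /\
    `|Z j| <= alpha j * sqnorm1 (h j) + (1 + B) * (alpha j * edge_energy y j).
  move=> j0; have [acq qE] := ey _ j0.
  have /sobolev1P[ach hL] := sh _ j0.
  have qL := abs_cont01_L2 acq.
  have cqL := in_L2Z (conjc (b j)) qL.
  have dqL : in_L2 (deriv01 (q j)).
    by apply: in_L2_eq cqL; apply: ae01_imp qE => t _ ->.
  have [th1 th0] := trace_le ach hL.
  have [tq1 tq0] := trace_le acq dqL.
  have dq : sqint (deriv01 (q j)) <= B * edge_energy y j.
    rewrite (sqint_eq cqL qE) sqintZ//.
    have -> : ip (conjc (b j)) (conjc (b j)) = ip (b j) (b j).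
      by rewrite /ip !ReImE mulrNN.
    by rewrite ler_wpM2r ?sqint_ge0// b_le.
  have key (v w : R[i]) : ip v v <= 2 * sqint (h j) + sqint (deriv01 (h j)) ->
      ip w w <= 2 * edge_energy y j + sqint (deriv01 (q j)) ->
      `|alpha j * ip v w| <=
      alpha j * sqnorm1 (h j) + (1 + B) * (alpha j * edge_energy y j).
    move=> hv hw; rewrite normrM gtr0_norm ?a_gt0// mulrCA -mulrDr ler_pM2l ?a_gt0//.
    apply: le_trans (ip_le v w) _; rewrite /sqnorm1.
    have d0 := sqint_ge0 (deriv01 (h j)).
    have BE : 0 <= B * edge_energy y j by rewrite mulr_ge0 ?sqint_ge0.
    exact: edge_bound_arith hv hw dq d0 BE.
  by split; [exact: (key _ _ th1 tq1)|exact: (key _ _ th0 tq0)].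
(* The root edge is the child of no internal vertex; its initial term disappears because [h] is zero
   at the root. *)
have Z1 : Z 1%N = 0 by rewrite /Z h0 /ip !mul0r addr0 mulr0.
have [sX hX] := has_sum1_dom (fun j j0 => (bound j j0).1) fC.
have fZ : summable1 (fun j => `|Z j|).
  by apply: esum1_fin_le fC => // j j0; exact: (bound j j0).2.
have [S [cS [sZ hZ hZ']]] := regroup (internal0 T) (nu_bij tree nu_enum) Z1 fZ.
exists S, (sX - sZ); split.
- move=> i ii; rewrite (_ : (fun l => _) = (fun l => Z (nu i l))); first exact: cS.
  apply/funext => l; rewrite /Z (alpha_child tree nu_enum pt_child)//.
  have [n1 ki] := nu_child tree nu_enum l ii.
  by rewrite -hc// ki /q; ring.
- apply: has_sum1_eq (has_sum1B hX hZ') => j j0.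
  case: ifPn => [_|nj]; first reflexivity.
  rewrite subr0 /X (h1 j); last by rewrite leafE.
  by rewrite /ip !mul0r addr0 mulr0.
- apply: has_sum1_eq (has_sum1B hX hZ) => j j0.
  have [acq qE] := ey _ j0; have /sobolev1P[ach _] := sh _ j0.
  by rewrite /cross /X /Z -mulrBr; congr (_ * _); rewrite -(green_edge ach acq qE).
Qed.

End Energy.

(** * Minimizers and the boundary value problem *)

Section Minimizers.
Variables (R : realType) (T : nat) (k d : nat -> nat) (nu : nat -> nat -> nat).
Variables (theta : nat -> R[i]) (p : nat -> R) (b : nat -> R[i]) (pt : nat -> R).
Local Notation Re := complex.Re.
Local Notation Im := complex.Im.
Hypothesis tree : tiered_tree T k d.
Hypothesis nu_enum : forall j, internal T j ->
  set_bij [set: nat] (children k j) (nu j).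
Variable M : R.
Hypothesis theta_le : forall l, normc (theta l) <= M.
Hypothesis p_gt0 : forall l, 0 < p l.
Hypothesis p_sum1 : series p @ \oo --> (1 : R).
Hypothesis b_child : forall j l, internal T j -> b (nu j l) = theta l.
Hypothesis pt_child : forall j l, internal T j -> pt (nu j l) = p l.
Local Notation alpha := (edge_weight k d pt).
Implicit Types y z h : nat -> R -> R[i].

Let Rei : Re 'i%C = 0 :> R. Proof. by []. Qed.
Let Imi : Im 'i%C = 1 :> R. Proof. by []. Qed.
Let Re0 : Re 0 = 0 :> R. Proof. by []. Qed.
Let Im0 : Im 0 = 0 :> R. Proof. by []. Qed.

Let a_gt0 j : (0 < j)%N -> 0 < alpha j.
Proof. exact: (alpha_gt0 tree nu_enum p_gt0 pt_child). Qed.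

(** Every edge other than the root edge carries some [theta l]; the coefficient of the root edge is
    free and enters as a separate summand. *)
Lemma edge_coef_le j : (0 < j)%N ->
  ip (b j) (b j) <= M ^+ 2 + ip (b 1%N) (b 1%N).
Proof.
move=> j0; have M2 : 0 <= M ^+ 2 := sqr_ge0 M.
have [j1|j1] := ltnP 1 j; last first.
  have -> : j = 1%N by apply/eqP; rewrite eqn_leq j1.
  by rewrite lerDr.
have [l <-] := nu_surj tree nu_enum j1.
rewrite b_child; last exact: (parent_internal tree j1).
rewrite -normc_sqr; apply: le_trans (_ : M ^+ 2 <= _); last by rewrite lerDl ip_ge0.
have n0 : 0 <= normc (theta l) by case: (theta l) => u v /=; exact: sqrtr_ge0.
have M0 : 0 <= M := le_trans n0 (theta_le l).
by rewrite ler_pXn2r.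
Qed.

Let B := M ^+ 2 + ip (b 1%N) (b 1%N).
Let b_le j : (0 < j)%N -> ip (b j) (b j) <= B := @edge_coef_le j.

Let B_ge0 : 0 <= B.
Proof. by rewrite addr_ge0 ?sqr_ge0 ?ip_ge0. Qed.

Let n0 z j : (0 < j)%N -> 0 <= alpha j * sqnorm1 (z j).
Proof. by move=> j0; rewrite mulr_ge0 ?sqnorm1_ge0// ltW// a_gt0. Qed.

(** By definition of [ell], [y' = q - b y] holds at every point, so [y'] inherits absolute
    continuity and can be differentiated again. *)
Lemma extremal_edge y j : sobolev 1 (y j) -> abs_cont01 (ell b y j) ->
  ae01 (fun t => deriv01 (ell b y j) t = conjc (b j) * ell b y j t) ->
  abs_cont01 (deriv01 (y j)) /\
  ae01 (fun t => deriv01 (deriv01 (y j)) t =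
    (conjc (b j) - b j) * deriv01 (y j) t + conjc (b j) * b j * y j t).
Proof.
move=> /sobolev1P[acy yL] acq qE.
have E : deriv01 (y j) = (fun t => ell b y j t + (- b j) * y j t).
  by apply/funext => t; rewrite /ell; ring.
have acby := abs_cont01Z (- b j) acy.
have ac1 : abs_cont01 (deriv01 (y j)) by rewrite E; exact: (abs_cont01D acq acby).
split; first exact: ac1.
have dd := deriv01D acq acby; rewrite -E in dd.
apply: ae01_imp3 dd qE (deriv01Z (- b j) acy) => t _ -> -> ->.
by rewrite /ell; ring.
Qed.

Lemma extremal_weighted2 y : weighted_sobolev alpha 1 y -> extremal b y ->
  weighted_sobolev alpha 2 y /\ edge_equations b y.
Proof.
move=> /weighted1P[sy fy] ey.
(* With [y'' = c1 y' + c2 y] the squared moduli of [c1] and [c2] are at most [4 * B] and [B ^+ 2];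
   [sqintD_le] doubles both. The constant is the same on all edges, which the weighted sum
   requires. *)
have s2 j : (0 < j)%N -> sobolev 2 (y j) /\
    sqint (deriv01 (deriv01 (y j))) <= (8 * B + 2 * B ^+ 2) * sqnorm1 (y j).
  move=> j0; have [acq qE] := ey _ j0.
  have [ac1 dE] := extremal_edge (sy _ j0) acq qE.
  have /sobolev1P[acy yL] := sy _ j0.
  have yL0 := abs_cont01_L2 acy.
  set c1 := conjc (b j) - b j in dE; set c2 := conjc (b j) * b j in dE.
  have L2 := in_L2D (in_L2Z c1 yL) (in_L2Z c2 yL0).
  split.
    apply/sobolev2P; split; [exact: acy|exact: ac1|].
    by apply: in_L2_eq L2; apply: ae01_imp dE => t _ ->.
  rewrite (sqint_eq L2 dE).
  apply: le_trans (sqintD_le (in_L2Z c1 yL) (in_L2Z c2 yL0)) _.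
  rewrite (sqintZ c1 yL) (sqintZ c2 yL0).
  have cc : ip (conjc (b j)) (conjc (b j)) = ip (b j) (b j).
    by rewrite /ip !ReImE mulrNN.
  have nn : ip (- b j) (- b j) = ip (b j) (b j).
    by rewrite /ip !ReImE !mulrNN.
  have h1 : ip c1 c1 <= 4 * B.
    apply: le_trans (ipD_le _ _) _; rewrite cc nn.
    have := b_le j0; move: (ip _ _) => x; lra.
  have h2 : ip c2 c2 <= B ^+ 2.
    rewrite ipM_sqr cc -expr2 ler_pXn2r// ?nnegrE ?ip_ge0//; exact: b_le.
  have q0 := sqint_ge0 (y j); have q1 := sqint_ge0 (deriv01 (y j)).
  rewrite /sqnorm1; move: (sqint (y j)) (sqint (deriv01 (y j))) q0 q1 => A A1 q0 q1.
  have g1 : ip c1 c1 * A1 <= 4 * B * A1 by apply: ler_wpM2r.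
  have g2 : ip c2 c2 * A <= B ^+ 2 * A by apply: ler_wpM2r.
  have g3 : 0 <= B * A by apply: mulr_ge0.
  have g4 : 0 <= B ^+ 2 * A1 by apply: mulr_ge0 => //; exact: sqr_ge0.
  move: g1 g2 g3 g4; move: (ip c1 c1 * A1) (ip c2 c2 * A) => x1 x2.
  have -> : (8 * B + 2 * B ^+ 2) * (A + A1) =
    8 * (B * A) + 8 * (B * A1) + 2 * (B ^+ 2 * A) + 2 * (B ^+ 2 * A1) by ring.
  have -> : 4 * B * A1 = 4 * (B * A1) by ring.
  move: (B * A) (B * A1) (B ^+ 2 * A) (B ^+ 2 * A1) => *; lra.
have K0 : 0 <= 1 + (8 * B + 2 * B ^+ 2).
  by rewrite !addr_ge0 ?mulr_ge0 ?sqr_ge0.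
split.
  split; first by move=> j /s2[].
  have f2 := esum1_finZ (1 + (8 * B + 2 * B ^+ 2)) (n0 y) fy.
  apply: le_lt_trans f2.
  have -> : (\sum_(1 <= j <oo) (alpha j)%:E * sqnorm_sobolev 2 (y j))%E =
      esum1 (fun j => alpha j * (sqnorm1 (y j) + sqint (deriv01 (deriv01 (y j))))).
    apply: eq_eseries1 => j j0; rewrite (sqnorm_sobolev2 (s2 _ j0).1).
    by rewrite /sqnorm1 EFinM.
  apply: esum1_le => j j0.
    by rewrite mulr_ge0 ?addr_ge0 ?sqnorm1_ge0 ?sqint_ge0// ltW// a_gt0.
  rewrite mulrCA; apply: ler_wpM2l; first by rewrite ltW// a_gt0.
  by rewrite mulrDl mul1r lerD2l; exact: (s2 _ j0).2.
move=> j j0; have [acq qE] := ey _ j0.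
have [_ dE] := extremal_edge (sy _ j0) acq qE.
apply: (@filterS _ _ (ae_filter_ringOfSetsType (@lebesgue_measure R)) _ _ _ dE).
move=> t H; rewrite /= in_itv /= => /andP[t0 t1]; rewrite H; last first.
  by apply/unit_itvP; rewrite !ltW.
have two : (2 : R[i]) = (2 : R)%:C by apply: complex_eq => //=; rewrite addr0.
rewrite normc_sqr two; apply: complex_eq; rewrite /ip !(Rei, Imi, ReImE) ?Re0 ?Im0;
  move: (deriv01 (y j) t) (b j) (y j t) => u v w;
  move: (Re u) (Im u) (Re v) (Im v) (Re w) (Im w) => *; ring.
Qed.

(** Inserting [y'' = - 2 i (Im b) y' + |b|^2 y] into [q' = y'' + b y'] gives [conjc b * q], because
    [b - 2 i Im b] is the conjugate of [b]. *)
Lemma bvp_extremal y : weighted_sobolev alpha 2 y -> edge_equations b y ->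
  extremal b y.
Proof.
move=> [s2 _] eqn j j0; have /sobolev2P[acy ac1 dL] := s2 _ j0.
have acq : abs_cont01 (ell b y j) by exact: (abs_cont01D ac1 (abs_cont01Z (b j) acy)).
split; first exact: acq.
have eE : ae01 (fun t => 0 < t < 1 -> - deriv01 (deriv01 (y j)) t
      - 2 * 'i%C * (Im (b j))%:C * deriv01 (y j) t
      + (normc (b j) ^+ 2)%:C * y j t = 0).
  apply: (@filterS _ _ (ae_filter_ringOfSetsType (@lebesgue_measure R)) _ _ _ (eqn _ j0)).
  by move=> t H _ t01; apply: H; rewrite /= in_itv.
apply: ae01_imp3 eE (deriv01D ac1 (abs_cont01Z (b j) acy)) (deriv01Z (b j) acy).
move=> t t01 /(_ t01) H E1 E2; rewrite [LHS]E1 E2 /ell.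
have two : (2 : R[i]) = (2 : R)%:C by apply: complex_eq => //=; rewrite addr0.
rewrite normc_sqr two in H.
have -> : deriv01 (deriv01 (y j)) t = - (2%:C * 'i%C * (Im (b j))%:C * deriv01 (y j) t)
      + (ip (b j) (b j))%:C * y j t.
  apply/eqP; rewrite -subr_eq0 -oppr_eq0 -[X in _ == X]H; apply/eqP.
  by move: (deriv01 _ _) (deriv01 _ _) => *; ring.
apply: complex_eq; rewrite /ip !(Rei, Imi, ReImE) ?Re0 ?Im0;
  move: (deriv01 (y j) t) (b j) (y j t) => u v w;
  move: (Re u) (Im u) (Re v) (Im v) (Re w) (Im w) => *; ring.
Qed.

(** The vertex conditions see only end values, so exchanging [y j0] for the extremal with the same
    end values gives an admissible competitor. The energies differ in one term of positive weight,
    which reduces minimality to [edge_minimal]. *)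
Lemma minimizer_extremal phi0 phi1 y :
  variational_solution T k alpha b phi0 phi1 y -> extremal b y.
Proof.
move=> [wy vy miny] j0 j00; have /weighted1P[sy fy] := wy.
have [w [q [w0 w1 acw acq wq]]] := edge_extremal (b j0) (y j0 0) (y j0 1).
have [sw min] := edge_minimal (sy _ j00) acw acq w0 w1 wq.
pose z j := if j == j0 then w else y j.
(* Used twice: with the squared norm, to see that the competitor lies in the space, and with the
   edge energy, to compare the two values of the functional. *)
have upd (F : (R -> R[i]) -> nat -> R) s : has_sum1 (fun j => alpha j * F (y j) j) s ->
    has_sum1 (fun j => alpha j * F (z j) j) (s + alpha j0 * (F w j0 - F (y j0) j0)).
  move=> hs; pose D j := if j == j0 then alpha j0 * (F w j0 - F (y j0) j0) else 0.
  have hD : has_sum1 D (D j0).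
    by apply: has_sum1_supp => // j _ jj; rewrite /D (negbTE jj).
  have := has_sum1D hs hD; rewrite {2}/D eqxx; apply: has_sum1_eq => j _.
  rewrite /D /z; case: eqVneq => [->|_]; last by rewrite addr0.
  by rewrite mulrBr addrC subrK.
have wz : weighted_sobolev alpha 1 z.
  apply/weighted1P; split.
    by move=> j j1; rewrite /z; case: eqVneq => _; [exact: sw|exact: sy].
  have [s hs _] := esum1P (n0 y) fy.
  by rewrite /summable1 (has_sum1_esum1 (upd (fun u _ => sqnorm1 u) _ hs)) ltry.
have z01 j : z j 0 = y j 0 /\ z j 1 = y j 1.
  by rewrite /z; case: eqVneq => [->|_].
have vz : vertex_conditions T k phi0 phi1 z.
  have [v0 vc v1] := vy; split.
  - by rewrite (z01 1%N).1.
  - by move=> j j2; rewrite (z01 _).1 (z01 _).2 vc.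
  - by move=> j lj; rewrite (z01 _).2 v1.
have [ey hy Ey] := energy_sum tree nu_enum p_gt0 pt_child b_le wy.
have [ez hz Ez] := energy_sum tree nu_enum p_gt0 pt_child b_le wz.
have := miny z wz vz; rewrite Ey Ez lee_fin.
have -> : ez = ey + alpha j0 * (sqint (edge_op (b j0) w) - sqint (edge_op (b j0) (y j0))).
  apply: (has_sum1_unique hz).
  exact: (upd (fun u j => sqint (edge_op (b j) u)) _ hy).
rewrite lerDl pmulr_rge0 ?a_gt0// subr_ge0 => /min yw.
(* Since [y j0] and [w] agree on all of [0,1], their one-sided derivatives at the endpoints agree as
   well. *)
have eq t : 0 <= t <= 1 -> q t = ell b y j0 t.
  move=> t01; rewrite /ell (eq_deriv01 t01 yw) (yw _ t01).
  by have [-> _] := wq _ t01; rewrite subrK.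
split; first exact: abs_cont01_eq eq acq.
apply: ae01_all => t /andP[t0 t1]; have t01 : 0 <= t <= 1 by rewrite !ltW.
rewrite -(eq_deriv01 t01 eq) -(eq _ t01).
by have [_ ->] := wq _ t01.
Qed.

Lemma cvg_series_lin (f g h : nat -> R) (a c F G H : R) :
  series f @ \oo --> F -> series g @ \oo --> G -> series h @ \oo --> H ->
  series (fun l => f l + a * g l + c * h l) @ \oo --> F + a * G + c * H.
Proof.
move=> cf cg ch.
rewrite (_ : series _ = (fun n => series f n + a * series g n + c * series h n)).
  apply: cvgD; first apply: cvgD; [exact: cf| |];
    by apply: cvgM; [exact: cvg_cst|].
by apply/funext => n; rewrite /series /= !big_split /= !mulr_sumr.
Qed.

(** The Kirchhoff condition in flux form, [q_i(1) = sum_l p_l q_{nu i l}(0)], split into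
    components. *)
Definition vertex_balance y i :=
  series (fun l => p l * Re (ell b y (nu i l) 0)) @ \oo --> Re (ell b y i 1) /\
  series (fun l => p l * Im (ell b y (nu i l) 0)) @ \oo --> Im (ell b y i 1).

Lemma beta_lim i : internal T i -> exists Th : R[i],
  [/\ beta nu pt b i = b i - Th,
      series (fun l => p l * Re (theta l)) @ \oo --> Re Th &
      series (fun l => p l * Im (theta l)) @ \oo --> Im Th].
Proof.
move=> ii.
have cp : cvgn (series p) by apply/cvg_ex; exists 1.
have tR l : `|Re (theta l)| <= M.
  apply: le_trans (theta_le l); case: (theta l) => u v /=.
  by rewrite -[leLHS]sqrtr_sqr ler_wsqrtr// lerDl sqr_ge0.
have tI l : `|Im (theta l)| <= M.
  apply: le_trans (theta_le l); case: (theta l) => u v /=.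
  by rewrite -[leLHS]sqrtr_sqr ler_wsqrtr// lerDr sqr_ge0.
have cR := cvg_series_dom p_gt0 cp tR; have cI := cvg_series_dom p_gt0 cp tI.
exists (limn (series (fun l => p l * Re (theta l))) +i*
        limn (series (fun l => p l * Im (theta l)))); split => //.
rewrite /beta; congr (b i - _).
apply: (@cvg_lim R[i]^o); first exact: norm_hausdorff.
apply/cvg_series_complexP; split => /=.
  rewrite (_ : (fun n => _) = (fun l => p l * Re (theta l)))//.
  by apply/funext => l; rewrite !ReImE b_child// pt_child// mul0r subr0.
rewrite (_ : (fun n => _) = (fun l => p l * Im (theta l)))//.
by apply/funext => l; rewrite !ReImE b_child// pt_child// mul0r addr0.
Qed.

(** Continuity at [v_i] turns [q_{nu i l}(0)] into [y_{nu i l}'(0) + theta_l y_i(1)]. Averaging with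
    the weights [p l] produces the extra term [Th * y i 1], exactly what [beta] subtracts from
    [b i]. *)
Lemma kirchhoffP phi0 phi1 y : vertex_conditions T k phi0 phi1 y ->
  kirchhoff_conditions T nu pt b y <-> forall i, internal T i -> vertex_balance y i.
Proof.
move=> [_ yc _].
have Q i l : internal T i ->
    ell b y (nu i l) 0 = deriv01 (y (nu i l)) 0 + theta l * y i 1.
  move=> ii; have [n1 ki] := nu_child tree nu_enum l ii.
  by rewrite /ell b_child// -yc// ki.
split=> H i ii; have [Th [bE cR cI]] := beta_lim ii.
  have := H i ii => /cvg_series_complexP[hR hI]; split.
    have := cvg_series_lin (a := Re (y i 1)) (c := - Im (y i 1)) hR cR cI.
    move=> h; rewrite (_ : Re (ell b y i 1) = Re (deriv01 (y i) 1 + beta nu pt b i * y i 1)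
        + Re (y i 1) * Re Th + - Im (y i 1) * Im Th).
      rewrite (_ : (fun l => _) = (fun l => Re ((pt (nu i l))%:C * deriv01 (y (nu i l)) 0)
        + Re (y i 1) * (p l * Re (theta l)) + - Im (y i 1) * (p l * Im (theta l)))).
        exact: h.
      by apply/funext => l; rewrite Q// pt_child// !ReImE; ring.
    by rewrite bE /ell !ReImE; ring.
  have := cvg_series_lin (a := Re (y i 1)) (c := Im (y i 1)) hI cI cR.
  move=> h; rewrite (_ : Im (ell b y i 1) = Im (deriv01 (y i) 1 + beta nu pt b i * y i 1)
      + Re (y i 1) * Im Th + Im (y i 1) * Re Th).
    rewrite (_ : (fun l => _) = (fun l => Im ((pt (nu i l))%:C * deriv01 (y (nu i l)) 0)
      + Re (y i 1) * (p l * Im (theta l)) + Im (y i 1) * (p l * Re (theta l)))).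
      exact: h.
    by apply/funext => l; rewrite Q// pt_child// !ReImE; ring.
  by rewrite bE /ell !ReImE; ring.
have [hR hI] := H i ii; apply/cvg_series_complexP; rewrite bE; split.
  have := cvg_series_lin (a := - Re (y i 1)) (c := Im (y i 1)) hR cR cI => h.
  rewrite (_ : Re _ = Re (ell b y i 1) + - Re (y i 1) * Re Th + Im (y i 1) * Im Th).
    rewrite (_ : (fun l => _) = (fun l => p l * Re (ell b y (nu i l) 0)
      + - Re (y i 1) * (p l * Re (theta l)) + Im (y i 1) * (p l * Im (theta l)))).
      exact: h.
    by apply/funext => l; rewrite Q// pt_child// !ReImE; ring.
  by rewrite /ell !ReImE; ring.
have := cvg_series_lin (a := - Re (y i 1)) (c := - Im (y i 1)) hI cI cR => h.
rewrite (_ : Im _ = Im (ell b y i 1) + - Re (y i 1) * Im Th + - Im (y i 1) * Re Th).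
  rewrite (_ : (fun l => _) = (fun l => p l * Im (ell b y (nu i l) 0)
    + - Re (y i 1) * (p l * Im (theta l)) + - Im (y i 1) * (p l * Re (theta l)))).
    exact: h.
  by apply/funext => l; rewrite Q// pt_child// !ReImE; ring.
by rewrite /ell !ReImE; ring.
Qed.

End Minimizers.

(** At [e = - s / (1 + |A|)] the expression is a negative multiple of [s ^+ 2], since
    [2 + 2 |A| - A] is positive whatever the sign of [A]. *)
Lemma quadratic_nonneg (R : realType) (A s : R) :
  (forall e, 0 <= e ^+ 2 * A + 2 * e * s) -> s = 0.
Proof.
move=> H; have c0 : 0 < 2 * (1 + `|A|) by rewrite mulr_gt0// ltr_wpDr.
have := H (- s / (1 + `|A|)).
have A1 : 0 < 1 + `|A| by rewrite ltr_wpDr.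
have AA : A <= `|A| := ler_norm A.
have -> : (- s / (1 + `|A|)) ^+ 2 * A + 2 * (- s / (1 + `|A|)) * s =
  - (s ^+ 2 * (2 + 2 * `|A| - A)) / (1 + `|A|) ^+ 2.
  by field; rewrite gt_eqF.
rewrite pmulr_lge0 ?invr_gt0 ?exprn_gt0// oppr_ge0 pmulr_lle0; last first.
  by have := normr_ge0 A; move: `|A| AA => a; lra.
move=> s2; apply/eqP; rewrite -sqrf_eq0 eq_le s2 sqr_ge0//.
Qed.

(** * Test tuples centred at one vertex, and the variational characterization *)

Section Star.
Variables (R : realType) (T : nat) (k d : nat -> nat) (nu : nat -> nat -> nat).
Variables (p : nat -> R) (b : nat -> R[i]) (pt : nat -> R).
Local Notation Re := complex.Re.
Local Notation Im := complex.Im.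
Hypothesis tree : tiered_tree T k d.
Hypothesis nu_enum : forall j, internal T j ->
  set_bij [set: nat] (children k j) (nu j).
Hypothesis p_gt0 : forall l, 0 < p l.
Hypothesis p_sum1 : series p @ \oo --> (1 : R).
Hypothesis pt_child : forall j l, internal T j -> pt (nu j l) = p l.
Variable B : R.
Hypothesis b_le : forall j, (0 < j)%N -> ip (b j) (b j) <= B.
Local Notation alpha := (edge_weight k d pt).
Implicit Types y z h : nat -> R -> R[i].

Let a_gt0 j : (0 < j)%N -> 0 < alpha j.
Proof. exact: (alpha_gt0 tree nu_enum p_gt0 pt_child). Qed.

Definition affine (c0 c1 : R[i]) (t : R) : R[i] := c0 + t%:C * c1.

Lemma affine_sobolev c0 c1 : sobolev 1 (affine c0 c1) /\
  forall t, 0 <= t <= 1 -> deriv01 (affine c0 c1) t = c1.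
Proof.
have D c c' t : is_cderive t (affine c c') c'.
  have := is_cderiveD (is_cderive_cst t c)
    (is_cderiveM (is_cderive_real (is_derive_id t (1 : R))) (is_cderive_cst t c')).
  by apply: is_cderive_eq; rewrite mulr0 addr0 mul1r add0r.
have cst (c : R[i]) : abs_cont01 (fun=> c).
  by apply: is_cderive_ac (fun t => is_cderive_cst t c) (fun t => is_cderive_cst t 0).
have E t : 0 <= t <= 1 -> deriv01 (affine c0 c1) t = c1.
  by move=> t01; apply: deriv01_cderive.
split; last exact: E.
apply/sobolev1P; split.
  exact: is_cderive_ac (D c0 c1) (fun t => is_cderive_cst t c1).
apply: in_L2_eq (abs_cont01_L2 (cst c1)).
by apply: ae01_all => t /andP[t0 t1]; rewrite E// !ltW.
Qed.

Lemma sqnorm1_affine0 : sqnorm1 (affine 0 0) = 0 :> R.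
Proof.
have [/sobolev1P[ac L2] dE] := affine_sobolev 0 0.
have z : sqint (affine 0 0) = 0 :> R.
  rewrite /sqint (_ : (fun t => _) = fun=> 0) ?int01_cst//.
  by apply/funext => t; rewrite /affine mulr0 addr0 /ip !ReImE mulr0 addr0.
rewrite /sqnorm1 z add0r -[RHS]z; apply: sqint_eq (abs_cont01_L2 ac) _.
apply: ae01_all => t /andP[t0 t1]; rewrite dE ?ltW//.
by rewrite /affine mulr0 addr0.
Qed.

(* The test function carrying the value [c] at [v_i] and vanishing at all other
   vertices. *)
Definition star (i : nat) (c : R[i]) (j : nat) : R -> R[i] :=
  if j == i then affine 0 c
  else if (1 < j)%N && (k j == i) then affine c (- c) else affine 0 0.

Lemma affine_at0 (c0 c1 : R[i]) : affine c0 c1 0 = c0.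
Proof. by rewrite /affine mul0r addr0. Qed.

Lemma affine_at1 (c0 c1 : R[i]) : affine c0 c1 1 = c0 + c1.
Proof. by rewrite /affine mul1r. Qed.

Lemma star_at1 i c j : star i c j 1 = if j == i then c else 0.
Proof.
rewrite /star; case: eqP => _; first by rewrite affine_at1 add0r.
by case: ifP => _; rewrite affine_at1 ?subrr ?addr0.
Qed.

Lemma star_test i c : internal T i -> test_conditions T k (star i c).
Proof.
move=> ii; split.
- by rewrite /star; case: ifP => _; rewrite /= affine_at0.
- move=> j j2; rewrite star_at1 /star j2 /=.
  have [ji|ji] := eqVneq j i.
    by rewrite -ji (negbTE (parent_neq tree j2)) affine_at0.
  by case: ifP => _; rewrite affine_at0.
- move=> j lj; rewrite star_at1; case: eqP => // ji.
  by move: lj; rewrite /leaf /= ji ii andbF.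
Qed.

Let child_weight i j : R := if (1 < j)%N && (k j == i) then alpha j else 0.

Let child_weight_ge0 i j : 0 <= child_weight i j.
Proof. by rewrite /child_weight; case: ifP => // /andP[j1 _]; rewrite ltW// a_gt0// ltnW. Qed.

(** Regrouping leaves the single group at [v_i], whose weights [p l * alpha i] add up to [alpha i]
    because the [p l] sum to 1. *)
Let child_weight_summable i : internal T i -> summable1 (child_weight i).
Proof.
move=> ii; rewrite /summable1 (regroup_ge0 (internal0 T) (nu_bij tree nu_enum))//.
pose w j : R := if j == i then alpha i else 0.
have hw : has_sum1 w (w i).
  by apply: has_sum1_supp (internal_gt0 ii) _ => j _ ji; rewrite /w (negbTE ji).
rewrite (_ : (\sum_(1 <= _ <oo) _)%E = esum1 w); first by rewrite (has_sum1_esum1 hw) ltry.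
apply: eq_eseries1 => j j0; rewrite /w; case: ifPn => ij; last first.
  by case: eqP => // ji; rewrite ji ii in ij.
have cE l : child_weight i (nu j l) = if j == i then p l * alpha j else 0.
  have [n1 kj] := nu_child tree nu_enum l ij.
  by rewrite /child_weight n1 kj /= (alpha_child tree nu_enum pt_child).
have [ji|ji] := eqVneq j i; last first.
  by apply: eseries0 => l _ _; rewrite cE (negbTE ji).
apply/cvg_lim => //.
rewrite (_ : (fun n => _) = EFin \o (fun n => series p n * alpha i)).
  apply: cvg_EFin; first exact: nearW.
  rewrite -[X in _ --> X](mul1r (alpha i)).
  by apply: cvgM; [exact: p_sum1|exact: cvg_cst].
apply/funext => n; rewrite /= /series /= mulr_suml -sumEFin.
by apply: eq_bigr => l _; rewrite cE ji eqxx.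
Qed.

(** All of the infinitely many edges leaving [v_i] carry the same affine function, so finiteness of
    the norm rests on the summability of their weights. *)
Lemma star_weighted i c : internal T i -> weighted_sobolev alpha 1 (star i c).
Proof.
move=> ii; apply/weighted1P; split.
  by move=> j _; rewrite /star; do 2?case: ifP => _; exact: (affine_sobolev _ _).1.
pose C := sqnorm1 (affine 0 c) + sqnorm1 (affine c (- c)).
pose w j : R := if j == i then alpha i else 0.
have hw : has_sum1 w (w i).
  by apply: has_sum1_supp (internal_gt0 ii) _ => j _ ji; rewrite /w (negbTE ji).
have w0 j : (0 < j)%N -> 0 <= w j.
  by move=> _; rewrite /w; case: ifP => // _; rewrite ltW// a_gt0// (internal_gt0 ii).
have fw : summable1 w by rewrite /summable1 (has_sum1_esum1 hw) ltry.
have v0 j (_ : (0 < j)%N) := child_weight_ge0 i j.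
have fin := esum1_finZ C (fun j j0 => addr_ge0 (w0 j j0) (v0 j j0))
  (esum1_finD w0 v0 fw (child_weight_summable ii)).
apply: esum1_fin_le fin => j j0.
  by rewrite mulr_ge0 ?sqnorm1_ge0// ltW// a_gt0.
have C1 : sqnorm1 (affine 0 c) <= C by rewrite lerDl sqnorm1_ge0.
have C2 : sqnorm1 (affine c (- c)) <= C by rewrite lerDr sqnorm1_ge0.
have C0 : 0 <= C := le_trans (sqnorm1_ge0 _) C1.
rewrite /star /w; have [->|ji] := eqVneq j i.
  rewrite [leRHS]mulrDr (mulrC C (alpha i)) -[leLHS]addr0; apply: lerD.
    by apply: ler_wpM2l C1; rewrite ltW// a_gt0// (internal_gt0 ii).
  by rewrite mulr_ge0.
rewrite add0r /child_weight; case: ifP => _.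
  by rewrite mulrC; apply: ler_wpM2r C2; rewrite ltW// a_gt0.
by rewrite sqnorm1_affine0 !mulr0.
Qed.

(** Along the real line [y + e h] the energy is [ey + e ^+ 2 * eh + 2 * e * s], and minimality at
    [e = 0] forces the linear coefficient to vanish. *)
Lemma minimizer_stationary phi0 phi1 y h ey eh s :
  variational_solution T k alpha b phi0 phi1 y ->
  weighted_sobolev alpha 1 h -> test_conditions T k h ->
  has_sum1 (fun j => alpha j * edge_energy b y j) ey -> energy alpha b y = ey%:E ->
  has_sum1 (fun j => alpha j * edge_energy b h j) eh ->
  has_sum1 (fun j => alpha j * cross b y h j) s -> s = 0.
Proof.
move=> [wy vy miny] wh th hy Ey hh hs.
apply: (quadratic_nonneg (A := eh)) => e.
have wz := weighted1_comb tree nu_enum p_gt0 pt_child e wy wh.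
have := miny _ wz (vertex_comb e vy th).
rewrite (energy_comb tree nu_enum p_gt0 pt_child b_le e wy wh hy hh hs) Ey lee_fin.
by rewrite -addrA lerDl.
Qed.

(** For [h = star i c] every bracket of [green_tree] at another vertex is zero, so stationarity says
    that the bracket at [i] is zero; the positive factor [alpha i] then cancels. *)
Lemma minimizer_flux phi0 phi1 y i c :
  variational_solution T k alpha b phi0 phi1 y -> extremal b y -> internal T i ->
  series (fun l => p l * ip c (ell b y (nu i l) 0)) @ \oo --> ip c (ell b y i 1).
Proof.
move=> vsy ey ii; have [wy vy miny] := vsy.
have wh := star_weighted c ii; have th := star_test c ii.
have [E hE EE] := energy_sum tree nu_enum p_gt0 pt_child b_le wy.
have [H hH _] := energy_sum tree nu_enum p_gt0 pt_child b_le wh.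
have [S [s [cS hS hs]]] := green_tree tree nu_enum p_gt0 pt_child b_le wy ey wh th.
have s0 := minimizer_stationary vsy wh th hE EE hH hs; subst s.
have i0 := internal_gt0 ii.
have ai0 : alpha i != 0 by rewrite gt_eqF// a_gt0.
have ip0 (z : R[i]) : ip 0 z = 0 by rewrite /ip !mul0r addr0.
have Si : S i = alpha i * ip c (ell b y i 1).
  have supp : has_sum1 (fun j => if internal T j then
      alpha j * ip (star i c j 1) (ell b y j 1) - S j else 0)
      (if internal T i then alpha i * ip (star i c i 1) (ell b y i 1) - S i else 0).
    apply: has_sum1_supp i0 _ => j _ ji; case: ifP => // ij.
    have : S j = 0.
      apply: (cvg_unique _ (cS j ij)) => //.
      rewrite (_ : series _ = fun=> 0); first exact: cvg_cst.
      apply/funext => n; rewrite /series /=; apply: big1 => l _.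
      by rewrite star_at1 (negbTE ji) ip0 !mulr0.
    by move=> ->; rewrite star_at1 (negbTE ji) ip0 mulr0 subrr.
  have := has_sum1_unique supp hS; rewrite ii star_at1 eqxx => /eqP.
  by rewrite subr_eq0 => /eqP.
have := cS i ii; rewrite Si star_at1 eqxx => cSi.
rewrite (_ : ip c _ = (alpha i)^-1 * (alpha i * ip c (ell b y i 1))); last first.
  by rewrite mulKf.
rewrite (_ : series _ = fun n => (alpha i)^-1 *
  series (fun l => alpha i * (p l * ip c (ell b y (nu i l) 0))) n).
  by apply: cvgM; [exact: cvg_cst|exact: cSi].
apply/funext => n; rewrite /series /= mulr_sumr; apply: eq_bigr => l _.
by rewrite mulKf.
Qed.

(** Pairing with 1 gives the real part of the flux and pairing with [i] the imaginary part. *)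
Lemma minimizer_balance phi0 phi1 y :
  variational_solution T k alpha b phi0 phi1 y -> extremal b y ->
  forall i, internal T i -> vertex_balance nu p b y i.
Proof.
move=> vsy ey i ii.
have r1 (z : R[i]) : ip 1 z = Re z by rewrite /ip /= mul1r mul0r addr0.
have ri (z : R[i]) : ip 'i%C z = Im z by rewrite /ip /= mul1r mul0r add0r.
split.
  have := minimizer_flux (c := 1) vsy ey ii; rewrite r1.
  by under [X in series X]eq_fun do rewrite r1.
have := minimizer_flux (c := 'i%C) vsy ey ii; rewrite ri.
by under [X in series X]eq_fun do rewrite ri.
Qed.

(** Any competitor is [y + h] with [h] zero at the root and at the leaves. The balances make the
    cross term vanish, so its energy is that of [y] plus that of [h]. *)
Lemma balanced_minimizer phi0 phi1 y : weighted_sobolev alpha 1 y ->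
  vertex_conditions T k phi0 phi1 y -> extremal b y ->
  (forall i, internal T i -> vertex_balance nu p b y i) ->
  variational_solution T k alpha b phi0 phi1 y.
Proof.
move=> wy vy ey bal; split; [exact: wy|exact: vy|move=> z wz vz].
pose h := comb (-1) z y.
have wh : weighted_sobolev alpha 1 h := weighted1_comb tree nu_enum p_gt0 pt_child (-1) wz wy.
have m1 : (-1)%:C = -1 :> R[i] by apply: complex_eq; rewrite ?ReImE//= oppr0.
have hE j t : h j t = z j t - y j t by rewrite /h /comb m1 mulN1r.
have th : test_conditions T k h.
  have [y0 yc y1] := vy; have [z0 zc z1] := vz; split.
  - by rewrite hE y0 z0 subrr.
  - by move=> j j2; rewrite !hE yc// zc.
  - by move=> j lj; rewrite hE y1// z1// subrr.
have [E hE' EE] := energy_sum tree nu_enum p_gt0 pt_child b_le wy.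
have [H hH _] := energy_sum tree nu_enum p_gt0 pt_child b_le wh.
have [S [s [cS hS hs]]] := green_tree tree nu_enum p_gt0 pt_child b_le wy ey wh th.
have s0 : s = 0.
  apply: (has_sum1_unique hS).
  apply: (@has_sum1_eq _ (fun=> 0)); last first.
    rewrite /has_sum1 (_ : (fun n => _) = fun=> 0); first exact: cvg_cst.
    by apply/funext => n; apply: big1.
  move=> i i0; case: ifP => // ii; have [bR bI] := bal i ii.
  suff -> : S i = alpha i * ip (h i 1) (ell b y i 1) by rewrite subrr.
  apply: (cvg_unique _ (cS i ii)) => //.
  (* The pairing with the fixed value [h i 1] is a real linear combination of the two component
     balances; the leading 0 is the sum of the zero series [c0]. *)
  rewrite (_ : alpha i * _ = 0 + (alpha i * Re (h i 1)) * Re (ell b y i 1)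
     + (alpha i * Im (h i 1)) * Im (ell b y i 1)); last first.
    by rewrite /ip; ring.
  have c0 : series (fun=> 0 : R) @ \oo --> (0 : R).
    rewrite (_ : series _ = fun=> 0); first exact: cvg_cst.
    by apply/funext => n; rewrite /series /= big1.
  have := cvg_series_lin (a := alpha i * Re (h i 1)) (c := alpha i * Im (h i 1)) c0 bR bI.
  rewrite (_ : (fun l => _) = (fun l => alpha i * (p l * ip (h i 1) (ell b y (nu i l) 0))))//.
  by apply/funext => l; rewrite /ip; ring.
have zE : z = comb 1 y h.
  apply/funext => j; apply/funext => t.
  by rewrite /comb hE mul1r addrC subrK.
rewrite zE EE (energy_comb tree nu_enum p_gt0 pt_child b_le 1 wy wh hE' hH hs) s0 lee_fin.
rewrite expr1n mul1r mulr0 addr0 lerDl.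
have := esum1_ge0 (a := fun j => alpha j * edge_energy b h j).
rewrite (has_sum1_esum1 hH) lee_fin; apply => j j0.
by rewrite mulr_ge0 ?sqint_ge0// ltW// a_gt0.
Qed.

End Star.

Theorem mainTheorem1 (R : realType) (T : nat) (k d : nat -> nat)
    (nu : nat -> nat -> nat) (theta : nat -> R[i]) (p : nat -> R)
    (b : nat -> R[i]) (pt : nat -> R) (phi0 phi1 : R[i])
    (T_ge2 : (2 <= T)%N)
    (tree : tiered_tree T k d)
    (nu_enum : forall j, internal T j -> set_bij [set: nat] (children k j) (nu j))
    (theta_bounded : exists M : R, forall l, normc (theta l) <= M)
    (p_gt0 : forall l, 0 < p l)
    (p_sum1 : series p @ \oo --> (1 : R))
    (b_child : forall j l, internal T j -> b (nu j l) = theta l)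
    (pt_child : forall j l, internal T j -> pt (nu j l) = p l)
    (y : nat -> R -> R[i])
    (y_W1 : weighted_sobolev (edge_weight k d pt) 1 y) :
  variational_solution T k (edge_weight k d pt) b phi0 phi1 y <->
  weighted_sobolev (edge_weight k d pt) 2 y /\
  boundary_value_solution T k nu pt b phi0 phi1 y.
Proof.
have [M theta_le] := theta_bounded.
have b_le := edge_coef_le tree nu_enum theta_le b_child.
split=> [vsy|[w2 [eqn vy kir]]].
  have ey := minimizer_extremal tree nu_enum theta_le p_gt0 b_child pt_child vsy.
  have [w2 eqn] := extremal_weighted2 tree nu_enum theta_le p_gt0 b_child pt_child y_W1 ey.
  have [_ vy _] := vsy.
  have bal := minimizer_balance tree nu_enum p_gt0 p_sum1 pt_child b_le vsy ey.
  split; first exact: w2.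
  split; [exact: eqn|exact: vy|].
  by apply/(kirchhoffP tree nu_enum theta_le p_gt0 p_sum1 b_child pt_child vy).
have ey := bvp_extremal w2 eqn.
apply: (balanced_minimizer tree nu_enum p_gt0 pt_child b_le y_W1 vy ey).
by apply/(kirchhoffP tree nu_enum theta_le p_gt0 p_sum1 b_child pt_child vy).
Qed.
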